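(* The rational map $$(w,x,y)\mapsto[H_{10}:H_{11}:H_{12}:H_{13}]\in\mathbb{P}^3$$ gives the involution $g_1$ of $X$.
   Context: Let $k$ be an algebraically closed field of characteristic $3$, $i=\sqrt{-1}\in k$, $\mathbb{F}_9=\mathbb{F}_3(i)$, and $X=\{w^4+x^4+y^4+z^4=0\}\subset\mathbb{P}^3_k$ the Fermat quartic surface; $(w,x,y)$ are the affine coordinates of $\mathbb{P}^3$ with $z=1$. The involution $g_1$. The rational map $(w,x,y)\mapsto[F_{10}:F_{11}:F_{12}]$ induces a morphism $\phi_1:X\to\mathbb{P}^2$ of degree $2$, with Stein factorization $X\to Y_1\xrightarrow{\pi_1}\mathbb{P}^2$, and $g_1\in\operatorname{Aut}(X)$ is the involution induced from the deck-transformation of $\pi_1$, where $F_{10}=(1+i)+(1+i)w+(1-i)x-y-(1-i)wx-x^2+iwy+ixy-iy^2+(1+i)w^3-iw^2x+(1+i)wx^2-ix^3+w^2y+(1+i)wxy+(1+i)x^2y-(1-i)wy^2-(1+i)xy^2+iy^3$, $F_{11}=(1-i)-(1+i)x-(1-i)y-(1-i)w^2-(1-i)wx-(1-i)x^2-(1+i)wy-xy-(1+i)y^2-w^3+(1-i)w^2x+wx^2-ix^3-(1+i)w^2y-(1+i)wxy+x^2y-iwy^2-xy^2+(1-i)y^3$, $F_{12}=(1+i)w-ix-y-w^2-wx-ix^2-ixy+iy^2+iw^3-(1+i)wx^2+ix^3-iw^2y-wxy+(1-i)wy^2+(1+i)y^3$. The polynomials $H_{1j}$. For $j=0,1,2,3$,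 $H_{1j}(w,x,y)=H_{1j0}(x,y)+H_{1j1}(x,y)\,w+H_{1j2}(x,y)\,w^2+H_{1j3}(x,y)\,w^3$, where $H_{100}=-1-(1-i)x-(1-i)x^2-(1+i)y^2-ix^3-(1-i)xy^2+x^4-(1-i)x^3y+(1+i)x^2y^2+(1+i)xy^3-(1-i)y^4-(1-i)x^5+(1+i)x^4y-(1-i)x^3y^2-ix^2y^3-ixy^4+iy^5+ix^6-x^5y-(1+i)x^4y^2-(1+i)x^3y^3+(1+i)xy^5+(1-i)y^6$, $H_{101}=(1+i)+x+(1-i)y-ix^2-(1+i)xy+iy^2+ix^3-x^2y-ixy^2+y^3+x^3y+(1-i)x^2y^2-(1-i)xy^3+(1-i)y^4+x^5+ix^4y+x^3y^2-ix^2y^3+(1-i)xy^4-(1-i)y^5$, $H_{102}=i+x+(1+i)y+x^2+(1+i)y^2+(1+i)x^3-x^2y-(1+i)xy^2+iy^3+(1+i)x^4+(1-i)x^2y^2+xy^3+(1+i)y^4$, $H_{103}=(1-i)-(1-i)x+(1-i)y-(1+i)x^2-(1-i)xy+(1+i)x^3-(1+i)y^3$, $H_{110}=-i+ix+y-(1+i)x^2+xy-(1-i)y^2-x^3-(1-i)x^2y+(1+i)xy^2-y^3+(1+i)x^4-ix^3y-(1-i)x^2y^2+xy^3+(1-i)y^4-(1+i)x^5+(1-i)x^4y+ix^2y^3-(1+i)xy^4-(1+i)y^5-ix^6+(1+i)x^4y^2+(1+i)x^3y^3+(1-i)xy^5-(1-i)y^6$, $H_{111}=-(1-i)+x+(1+i)y-(1+i)x^2-ixy-iy^2+(1-i)x^3-ix^2y-y^3+(1+i)x^4+(1-i)x^3y-x^2y^2+(1+i)xy^3-iy^4+(1-i)x^5+ix^4y+(1-i)x^2y^3+(1-i)xy^4-y^5$,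 $H_{112}=-1+(1+i)y+x^2-(1-i)xy-(1+i)y^2-x^2y+(1+i)xy^2-(1+i)y^3+(1-i)x^4+(1+i)x^3y-(1+i)x^2y^2-xy^3-(1+i)y^4$, $H_{113}=(1+i)-x+y+x^2-iy^2-(1-i)x^3+ix^2y-(1-i)xy^2-iy^3$, $H_{120}=(1+i)+(1+i)x+(1+i)y+(1-i)x^2+y^2+(1+i)x^3+(1+i)x^2y-ixy^2-y^3-(1-i)x^3y+(1-i)x^2y^2-(1+i)xy^3+(1-i)y^4+(1-i)x^5-ix^4y+(1-i)x^3y^2-(1+i)x^2y^3+ixy^4-y^5+x^6-(1+i)x^5y-(1-i)x^4y^2+x^3y^3-ix^2y^4-(1-i)xy^5+(1-i)y^6$, $H_{121}=i+x+xy-(1+i)y^2+x^3-(1+i)x^2y-(1-i)xy^2+(1+i)y^3+x^4-(1-i)x^3y-(1-i)x^2y^2+(1+i)xy^3-(1-i)y^4-(1-i)x^5+(1+i)x^3y^2+(1+i)x^2y^3+(1-i)y^5$, $H_{122}=(1-i)-x-(1+i)y+ix^2-(1-i)xy-(1+i)y^2-x^3-(1-i)xy^2-iy^3-(1+i)x^4-(1-i)x^3y-(1+i)x^2y^2-xy^3+(1+i)y^4$, $H_{123}=1-(1+i)x+(1-i)y+x^2+ixy+iy^2-(1+i)x^3+(1-i)x^2y-(1+i)xy^2+(1+i)y^3$, $H_{130}=-(1-i)+ix+(1+i)y-(1+i)x^2+(1-i)xy+(1-i)y^2+x^3-(1+i)x^2y+ixy^2+iy^3-(1+i)x^4+ix^3y+x^2y^2-(1+i)y^4+(1+i)x^5-(1-i)x^4y+(1-i)x^3y^2-x^2y^3-(1+i)y^5-(1+i)x^6-(1-i)x^5y-(1+i)x^4y^2+ix^3y^3+ix^2y^4+ixy^5+(1+i)y^6$,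 $H_{131}=-1-x+(1+i)y-(1-i)x^2+(1+i)xy-iy^2-(1+i)x^3-ix^2y-xy^2+iy^3-x^4-x^3y+xy^3-(1+i)y^4-(1+i)x^5+x^4y+(1-i)x^3y^2-ix^2y^3+(1+i)xy^4$, $H_{132}=(1+i)+ix+y-x^2+xy+y^2+ix^3-(1-i)x^2y-(1+i)xy^2-(1-i)x^4-x^2y^2-ixy^3-(1-i)y^4$, $H_{133}=i-y+x^2+(1+i)xy-(1-i)y^2$. *)

(* Defs.v *)
From HB Require Import structures.
From mathcomp Require Import all_boot all_order all_algebra.
From mathcomp Require Import boolp classical_sets topology_structure.
From mathcomp Require Import initial_topology subtype_topology.
From mathcomp Require Import mpoly.

Set Implicit Arguments.
Unset Strict Implicit.
Unset Printing Implicit Defensive.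

Import GRing.Theory.
Local Open Scope classical_set_scope.
Local Open Scope ring_scope.

(* Classical varieties over k as "spaces with functions": a topological space
   with a sheaf of k-valued functions that is a sheaf of k-algebras, in which
   the locus where a regular function is nonzero is open and carries its
   inverse.  Functions are total; regular U f, used for open U only, depends
   only on the restriction of f to U. *)
Record kspace (k : fieldType) := KSpace {
  kpt :> topologicalType;
  regular : set kpt -> (kpt -> k) -> Prop;
  regular_eq : forall (U : set kpt) (f g : kpt -> k), open U ->
    (forall x, U x -> f x = g x) -> regular U f -> regular U g;
  regular_restr : forall (U V : set kpt) (f : kpt -> k), open U -> open V ->
    V `<=` U -> regular U f -> regular V f;
  regular_glue : forall (U : set kpt) (f : kpt -> k), open U ->
    (forall x, U x -> exists V, [/\ open V, V x, V `<=` U & regular V f]) ->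
    regular U f;
  regular_cst : forall (U : set kpt) (c : k), open U -> regular U (fun=> c);
  regular_sub : forall (U : set kpt) (f g : kpt -> k), open U ->
    regular U f -> regular U g -> regular U (fun x => f x - g x);
  regular_mul : forall (U : set kpt) (f g : kpt -> k), open U ->
    regular U f -> regular U g -> regular U (fun x => f x * g x);
  regular_inv : forall (U : set kpt) (f : kpt -> k), open U -> regular U f ->
    open (U `&` [set x | f x != 0]) /\
    regular (U `&` [set x | f x != 0]) (fun x => (f x)^-1)
}.

Lemma open_local (T : topologicalType) (U : set T) :
  (forall x, U x -> exists V, [/\ open V, V x & V `<=` U]) -> open U.
Proof.
move=> h; rewrite openE => x /h [V [oV Vx VU]].
by rewrite /interior /= nbhsE; exists V.
Qed.

(* The structure induced on a subset A: functions locally restricted from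
   regular functions of the ambient space. *)
Section InducedSpace.
Variables (k : fieldType) (S : kspace k) (A : set S).

Definition sub_regular (U : set (set_type A)) (f : set_type A -> k) : Prop :=
  forall x, U x -> exists V (g : S -> k),
    [/\ open V, V (\val x), regular V g &
        forall y, U y -> V (\val y) -> f y = g (\val y)].

Lemma open_sub_preim (V : set S) : open V ->
  open ([set x | V (\val x)] : set (set_type A)).
Proof. by move=> oV; exists V. Qed.

Lemma sub_regular_eq (U : set (set_type A)) f g : open U ->
  (forall x, U x -> f x = g x) -> sub_regular U f -> sub_regular U g.
Proof.
move=> _ fg Uf x Ux; have [V [h [oV Vx rh fh]]] := Uf x Ux.
by exists V, h; split=> // y Uy Vy; rewrite -fg // fh.
Qed.

Lemma sub_regular_restr (U V : set (set_type A)) f : open U -> open V ->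
  V `<=` U -> sub_regular U f -> sub_regular V f.
Proof.
move=> _ _ VU Uf x Vx; have [W [h [oW Wx rh fh]]] := Uf x (VU x Vx).
by exists W, h; split=> // y /VU; apply: fh.
Qed.

Lemma sub_regular_glue (U : set (set_type A)) f : open U ->
  (forall x, U x -> exists V, [/\ open V, V x, V `<=` U & sub_regular V f]) ->
  sub_regular U f.
Proof.
move=> _ Uf x Ux; have [V [oV Vx VU Vf]] := Uf x Ux.
have [W [h [oW Wx rh fh]]] := Vf x Vx.
have [B oB BV] := oV.
have oWB : open (W `&` B) by apply: openI.
exists (W `&` B), h; split=> //.
- by split=> //; move: Vx; rewrite -BV.
- by apply: regular_restr rh => // y [].
- by move=> y _ [Wy By]; apply: fh => //; rewrite -BV.
Qed.

Lemma sub_regular_cst (U : set (set_type A)) (c : k) : open U ->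
  sub_regular U (fun=> c).
Proof.
move=> _ x Ux; exists setT, (fun=> c); split=> //; first exact: openT.
exact/regular_cst/openT.
Qed.

Lemma sub_regular_op2 (op : k -> k -> k) :
  (forall (V : set S) f g, open V -> regular V f -> regular V g ->
     regular V (fun x => op (f x) (g x))) ->
  forall (U : set (set_type A)) f g, open U -> sub_regular U f ->
    sub_regular U g -> sub_regular U (fun x => op (f x) (g x)).
Proof.
move=> hop U f g oU Uf Ug x Ux.
have [V [f' [oV Vx rf ff']]] := Uf x Ux.
have [W [g' [oW Wx rg gg']]] := Ug x Ux.
have oVW : open (V `&` W) by apply: openI.
exists (V `&` W), (fun z => op (f' z) (g' z)); split=> //.
- apply: hop => //.
    by apply: regular_restr rf => // y [].
  by apply: regular_restr rg => // y [].
- by move=> y Uy [Vy Wy]; rewrite ff' // gg'.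
Qed.

Lemma sub_regular_sub (U : set (set_type A)) f g : open U ->
  sub_regular U f -> sub_regular U g -> sub_regular U (fun x => f x - g x).
Proof.
by apply: (sub_regular_op2 (op := fun a b => a - b)) => *; apply: regular_sub.
Qed.

Lemma sub_regular_mul (U : set (set_type A)) f g : open U ->
  sub_regular U f -> sub_regular U g -> sub_regular U (fun x => f x * g x).
Proof.
by apply: (sub_regular_op2 (op := fun a b => a * b)) => *; apply: regular_mul.
Qed.

Lemma sub_regular_inv (U : set (set_type A)) f : open U -> sub_regular U f ->
  open (U `&` [set x | f x != 0]) /\
  sub_regular (U `&` [set x | f x != 0]) (fun x => (f x)^-1).
Proof.
move=> oU Uf; split.
  apply: open_local => x [Ux fx0].
  have [V [h [oV Vx rh fh]]] := Uf x Ux.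
  have [oD _] := regular_inv oV rh.
  exists (U `&` [set y | (V `&` [set z | h z != 0]) (\val y)]); split.
  - by apply: openI => //; apply: open_sub_preim.
  - by split=> //; split=> //=; rewrite -fh.
  - by move=> y [Uy [Vy hy]]; split=> //=; rewrite fh.
move=> x [Ux fx0]; have [V [h [oV Vx rh fh]]] := Uf x Ux.
have [oD rD] := regular_inv oV rh.
exists (V `&` [set z | h z != 0]), (fun z => (h z)^-1); split=> //.
- by split=> //=; rewrite -fh.
- by move=> y [Uy _] [Vy _]; rewrite fh.
Qed.

Definition ksub : kspace k :=
  KSpace sub_regular_eq sub_regular_restr sub_regular_glue sub_regular_cst
    sub_regular_sub sub_regular_mul sub_regular_inv.

End InducedSpace.

(* Affine n-space with the Zariski topology; an alias of 'rV[k]_n, so that no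
   other topology on matrices can interfere. *)
Definition aspace_pt (k : fieldType) (n : nat) : Type := 'rV[k]_n.
HB.instance Definition _ k n := Choice.on (aspace_pt k n).

Definition aeval (k : fieldType) (n : nat) (p : {mpoly k[n]})
  (P : aspace_pt k n) : k := p.@[fun j => (P : 'rV[k]_n) 0 j].

(* Points of projective n-space are the lines of k^(n+1). *)
Definition pspace_pt (k : fieldType) (n : nat) : Type :=
  {L : {vspace 'rV[k]_n.+1} | \dim L == 1%N}.
HB.instance Definition _ k n := Choice.on (pspace_pt k n).

(* Homogeneous coordinates, with the scaling chosen by vpick; only the vanishing
   of a homogeneous polynomial, or the ratio of two of the same degree, is
   meaningful. *)
Definition pcoord (k : fieldType) (n : nat) (P : pspace_pt k n) :
  'rV[k]_n.+1 := vpick (val P).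
Definition peval (k : fieldType) (n : nat) (p : {mpoly k[n.+1]})
  (P : pspace_pt k n) : k := p.@[fun j => pcoord P 0 j].

(* Common construction of affine and projective space: the nonvanishing loci of
   the forms p (hom d p for some degree d) are a base of the Zariski topology,
   and regular functions are locally quotients of two forms of equal degree.
   For affine space every polynomial is a form of every degree. *)
Section FormSpace.
Variables (k : fieldType) (T : choiceType) (R : nzRingType).
Variables (ev : R -> T -> k) (hom : nat -> R -> Prop).
Hypothesis evB : forall p q P, ev (p - q) P = ev p P - ev q P.
Hypothesis evM : forall p q P, ev (p * q) P = ev p P * ev q P.
Hypothesis evC : forall c, exists2 p, hom 0%N p & forall P, ev p P = c.
Hypothesis homB : forall d p q, hom d p -> hom d q -> hom d (p - q).
Hypothesis homM : forall d e p q,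
  hom d p -> hom e q -> hom (d + e)%N (p * q).

Definition form_open (U : set T) : Prop :=
  forall P, U P -> exists d p,
    [/\ hom d p, ev p P != 0 & forall Q, ev p Q != 0 -> U Q].

Definition form_regular (U : set T) (f : T -> k) : Prop :=
  forall P, U P -> exists d a b,
    [/\ hom d a, hom d b, ev b P != 0 &
        forall Q, U Q -> ev b Q != 0 -> f Q = ev a Q / ev b Q].

Lemma form_openT : form_open setT.
Proof.
move=> P _; have [p hp p1] := evC 1.
by exists 0%N, p; split=> //; rewrite p1 oner_neq0.
Qed.

Lemma form_openI : setI_closed form_open.
Proof.
move=> U V oU oV P [/oU [d [p [hp pP pU]]] /oV [e [q [hq qP qV]]]].
exists (d + e)%N, (p * q); split; first exact: homM.
  by rewrite evM mulf_neq0.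
by move=> Q; rewrite evM mulf_eq0 negb_or => /andP[/pU ? /qV].
Qed.

Lemma form_open_bigU (I : Type) (f : I -> set T) :
  (forall i, form_open (f i)) -> form_open (\bigcup_i f i).
Proof.
move=> of_ P [i _ /of_ [d [p [hp pP pU]]]].
by exists d, p; split=> // Q /pU; exists i.
Qed.

Lemma form_regular_eq (U : set T) f g :
  (forall x, U x -> f x = g x) -> form_regular U f -> form_regular U g.
Proof.
move=> fg Uf P UP; have [d [a [b [ha hb bP fab]]]] := Uf P UP.
by exists d, a, b; split=> // Q UQ bQ; rewrite -fg // fab.
Qed.

Lemma form_regular_restr (U V : set T) f :
  V `<=` U -> form_regular U f -> form_regular V f.
Proof.
move=> VU Uf P VP; have [d [a [b [ha hb bP fab]]]] := Uf P (VU _ VP).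
by exists d, a, b; split=> // Q /VU; apply: fab.
Qed.

Lemma form_regular_glue (U : set T) f :
  (forall P, U P ->
     exists V, [/\ form_open V, V P, V `<=` U & form_regular V f]) ->
  form_regular U f.
Proof.
move=> Uf P UP; have [V [oV VP _ Vf]] := Uf P UP.
have [d [a [b [ha hb bP fab]]]] := Vf P VP.
have [e [p [hp pP pV]]] := oV P VP.
exists (d + e)%N, (a * p), (b * p); split; try exact: homM.
  by rewrite evM mulf_neq0.
move=> Q _; rewrite !evM mulf_eq0 negb_or => /andP[bQ pQ].
by rewrite (fab Q (pV Q pQ) bQ) -mulf_div (divff pQ) mulr1.
Qed.

Lemma form_regular_cst (U : set T) (c : k) : form_regular U (fun=> c).
Proof.
move=> P _; have [p hp pc] := evC c; have [q hq q1] := evC 1.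
exists 0%N, p, q; split=> //; first by rewrite q1 oner_neq0.
by move=> Q _ _; rewrite pc q1 divr1.
Qed.

Lemma form_regular_sub (U : set T) f g :
  form_regular U f -> form_regular U g -> form_regular U (fun x => f x - g x).
Proof.
move=> Uf Ug P UP; have [d [a [b [ha hb bP fab]]]] := Uf P UP.
have [e [a' [b' [ha' hb' bP' fab']]]] := Ug P UP.
have hac : forall p q r s, hom d p -> hom e q -> hom d r -> hom e s ->
    hom (d + e)%N (p * q - r * s).
  by move=> *; apply: homB; apply: homM.
exists (d + e)%N, (a * b' - b * a'), (b * b'); split; try exact: homM.
- exact: hac.
- by rewrite evM mulf_neq0.
move=> Q UQ; rewrite evB !evM mulf_eq0 negb_or => /andP[bQ bQ'].
by rewrite fab // fab' // -mulNr addf_div // mulNr [ev a' Q * _]mulrC.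
Qed.

Lemma form_regular_mul (U : set T) f g :
  form_regular U f -> form_regular U g -> form_regular U (fun x => f x * g x).
Proof.
move=> Uf Ug P UP; have [d [a [b [ha hb bP fab]]]] := Uf P UP.
have [e [a' [b' [ha' hb' bP' fab']]]] := Ug P UP.
exists (d + e)%N, (a * a'), (b * b'); split; try exact: homM.
  by rewrite evM mulf_neq0.
move=> Q UQ; rewrite !evM mulf_eq0 negb_or => /andP[bQ bQ'].
by rewrite fab // fab' // mulf_div.
Qed.

Lemma form_regular_inv (U : set T) f : form_open U -> form_regular U f ->
  form_open (U `&` [set x | f x != 0]) /\
  form_regular (U `&` [set x | f x != 0]) (fun x => (f x)^-1).
Proof.
move=> oU Uf; split=> P [UP /= fP];
    have [d [a [b [ha hb bP fab]]]] := Uf P UP.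
  have [e [p [hp pP pU]]] := oU P UP.
  have aP : ev a P != 0.
    by apply: contra fP => /eqP aP; rewrite fab // aP mul0r.
  exists (d + d + e)%N, (a * b * p); split.
  - by apply: (homM (homM _ _)).
  - by rewrite !evM !mulf_neq0.
  move=> Q; rewrite !evM !mulf_eq0 !negb_or -andbA => /and3P[aQ bQ /pU UQ].
  by split=> //=; rewrite fab // mulf_neq0 // invr_eq0.
have aP : ev a P != 0.
  by apply: contra fP => /eqP aP; rewrite fab // aP mul0r.
exists (d + d)%N, (b * b), (b * a); split; try exact: homM.
  by rewrite evM mulf_neq0.
move=> Q [UQ _]; rewrite !evM mulf_eq0 negb_or => /andP[bQ aQ].
by rewrite (fab Q UQ bQ) invf_div -mulf_div (divff bQ) mul1r.
Qed.

End FormSpace.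

Section AffineSpace.
Variables (k : fieldType) (n : nat).
Local Notation ev := (@aeval k n).
Local Notation hom := (fun (_ : nat) (_ : {mpoly k[n]}) => True).

Lemma aevB p q P : ev (p - q) P = ev p P - ev q P.
Proof. exact: mevalB. Qed.
Lemma aevM p q P : ev (p * q) P = ev p P * ev q P.
Proof. exact: mevalM. Qed.
Lemma aevC c : exists2 p, hom 0%N p & forall P, ev p P = c.
Proof. by exists c%:MP => // P; apply: mevalC. Qed.
Lemma ahomB d p q : hom d p -> hom d q -> hom d (p - q). Proof. by []. Qed.
Lemma ahomM d e p q : hom d p -> hom e q -> hom (d + e)%N (p * q).
Proof. by []. Qed.

HB.instance Definition _ := isOpenTopological.Build (aspace_pt k n)
  (form_openT aevC) (form_openI aevM ahomM) (@form_open_bigU _ _ _ ev hom).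

Definition aspace : kspace k := @KSpace k (aspace_pt k n) (form_regular ev hom)
  (fun U f g _ => @form_regular_eq _ _ _ ev hom U f g)
  (fun U V f _ _ => @form_regular_restr _ _ _ ev hom U V f)
  (fun U f _ => @form_regular_glue _ _ _ ev hom aevM ahomM U f)
  (fun U c _ => form_regular_cst aevC c)
  (fun U f g _ => form_regular_sub aevB aevM ahomB ahomM
     (U := U) (f := f) (g := g))
  (fun U f g _ => form_regular_mul aevM ahomM (U := U) (f := f) (g := g))
  (fun U f oU => form_regular_inv aevM ahomM oU).

End AffineSpace.

Section ProjectiveSpace.
Variables (k : fieldType) (n : nat).
Local Notation ev := (@peval k n).
Local Notation hom :=
  (fun (d : nat) (p : {mpoly k[n.+1]}) => p \is d.-homog : Prop).

Lemma pevB p q P : ev (p - q) P = ev p P - ev q P.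
Proof. exact: mevalB. Qed.
Lemma pevM p q P : ev (p * q) P = ev p P * ev q P.
Proof. exact: mevalM. Qed.
Lemma pevC c : exists2 p, hom 0%N p & forall P, ev p P = c.
Proof.
exists c%:MP; last by move=> P; apply: mevalC.
by rewrite -alg_mpolyC rpredZ // dhomog1.
Qed.
Lemma phomB d p q : hom d p -> hom d q -> hom d (p - q).
Proof. exact: rpredB. Qed.
Lemma phomM d e p q : hom d p -> hom e q -> hom (d + e)%N (p * q).
Proof. exact: dhomogM. Qed.

HB.instance Definition _ := isOpenTopological.Build (pspace_pt k n)
  (form_openT pevC) (form_openI pevM phomM) (@form_open_bigU _ _ _ ev hom).

Definition pspace : kspace k := @KSpace k (pspace_pt k n) (form_regular ev hom)
  (fun U f g _ => @form_regular_eq _ _ _ ev hom U f g)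
  (fun U V f _ _ => @form_regular_restr _ _ _ ev hom U V f)
  (fun U f _ => @form_regular_glue _ _ _ ev hom pevM phomM U f)
  (fun U c _ => form_regular_cst pevC c)
  (fun U f g _ => form_regular_sub pevB pevM phomB phomM
     (U := U) (f := f) (g := g))
  (fun U f g _ => form_regular_mul pevM phomM (U := U) (f := f) (g := g))
  (fun U f oU => form_regular_inv pevM phomM oU).

End ProjectiveSpace.

Section Morphisms.
Variable k : fieldType.
Implicit Types S T Y : kspace k.

Definition kmorphism S T (f : S -> T) : Prop :=
  continuous f /\ forall (V : set T) (h : T -> k),
    open V -> regular V h -> regular (f @^-1` V) (h \o f).

Definition kisomorphism S T (f : S -> T) : Prop :=
  exists g : T -> S, [/\ kmorphism f, kmorphism g, cancel f g & cancel g f].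

Definition affine S : Prop :=
  exists n (Z : set (aspace k n)), closed Z /\
    exists f : S -> ksub Z, kisomorphism f.

Definition finite_morphism S T (f : S -> T) : Prop :=
  kmorphism f /\ forall y : T, exists V : set T,
    [/\ open V, V y, affine (ksub V), affine (ksub (f @^-1` V)) &
      exists n (e : 'I_n -> S -> k),
        (forall j, regular (f @^-1` V) (e j)) /\
        forall h, regular (f @^-1` V) h ->
          exists c : 'I_n -> T -> k, (forall j, regular V (c j)) /\
            forall x, V (f x) -> h x = \sum_(j < n) c j (f x) * e j x].

(* O_T -> f_* O_S is an isomorphism *)
Definition pushforward_structure_sheaf S T (f : S -> T) : Prop :=
  forall V : set T, open V ->
    (forall h, regular V h -> (forall x, V (f x) -> h (f x) = 0) ->
       forall y, V y -> h y = 0) /\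
    (forall h, regular (f @^-1` V) h ->
       exists2 h', regular V h' & forall x, V (f x) -> h x = h' (f x)).

Definition stein_factorization S Y T (f : S -> T) (rho : S -> Y)
    (pi : Y -> T) : Prop :=
  [/\ kmorphism rho, pushforward_structure_sheaf rho, finite_morphism pi &
      forall x, pi (rho x) = f x].

Definition deck_transformation S T (f : S -> T) (tau : S -> S) : Prop :=
  kisomorphism tau /\ forall x, f (tau x) = f x.

(* Representatives of rational functions; two are equal in k(S) when they agree
   on a dense open set, equivalently on the intersection of their domains. *)
Record ratfun S := Ratfun {
  rdom : set S;
  rval :> S -> k;
  rdom_open : open rdom;
  rdom_dense : dense rdom;
  rval_regular : regular rdom rval
}.

(* f = \sum_j phi^*(c_j) e_j in k(S), for phi : S -> T dominant *)
Definition rat_comb S T (phi : S -> T) d (e : 'I_d -> ratfun S)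
    (c : 'I_d -> ratfun T) (f : ratfun S) : Prop :=
  exists W : set S, [/\ open W, dense W, W `<=` rdom f,
    forall j, W `<=` rdom (e j) `&` phi @^-1` rdom (c j) &
    forall x, W x -> f x = \sum_(j < d) c j (phi x) * e j x].

(* phi is dominant and [k(S) : phi^* k(T)] = d, for S and T irreducible *)
Definition has_degree S T (phi : S -> T) (d : nat) : Prop :=
  dense (range phi) /\ exists e : 'I_d -> ratfun S,
    (forall f, exists c, rat_comb phi e c f) /\
    (forall c f, rat_comb phi e c f -> (forall x, rdom f x -> f x = 0) ->
       forall j y, rdom (c j) y -> c j y = 0).

End Morphisms.

Section FermatQuartic.
Variable k : fieldType.

(* Homogeneous coordinates on P^3 are in the order (w, x, y, z). *)
Definition fermat_quartic : kspace k :=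
  ksub [set P : pspace k 3 | \sum_(j < 4) pcoord P 0 j ^+ 4 = 0].

Definition fermat_incl (P : fermat_quartic) : pspace k 3 := val P.

Definition affine_point (w x y : k) : 'rV[k]_4 :=
  \row_(j < 4) [:: w; x; y; 1]`_j.

(* The rational map (w,x,y) |-> [A w x y] is defined on X (on a dense open set
   of points with z = 1), and f agrees with it wherever A is nonzero. *)
Definition induced_by n (A : k -> k -> k -> 'rV[k]_n.+1)
    (f : fermat_quartic -> pspace k n) : Prop :=
  dense [set P : fermat_quartic | exists w x y,
    val (fermat_incl P) = <[affine_point w x y]>%VS /\ A w x y != 0] /\
  forall (P : fermat_quartic) w x y,
    val (fermat_incl P) = <[affine_point w x y]>%VS -> A w x y != 0 ->
    val (f P) = <[A w x y]>%VS.

End FermatQuartic.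

Definition F10 (R : nzRingType) (i w x y : R) : R :=
    (1 + i) + (1 + i) * w + (1 - i) * x - y - (1 - i) * w * x - x ^+ 2
    + i * w * y + i * x * y - i * y ^+ 2 + (1 + i) * w ^+ 3 - i * w ^+ 2 * x
    + (1 + i) * w * x ^+ 2 - i * x ^+ 3 + w ^+ 2 * y + (1 + i) * w * x * y
    + (1 + i) * x ^+ 2 * y - (1 - i) * w * y ^+ 2 - (1 + i) * x * y ^+ 2
    + i * y ^+ 3.

Definition F11 (R : nzRingType) (i w x y : R) : R :=
    (1 - i) - (1 + i) * x - (1 - i) * y - (1 - i) * w ^+ 2 - (1 - i) * w * x
    - (1 - i) * x ^+ 2 - (1 + i) * w * y - x * y - (1 + i) * y ^+ 2 - w ^+ 3
    + (1 - i) * w ^+ 2 * x + w * x ^+ 2 - i * x ^+ 3 - (1 + i) * w ^+ 2 * y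
    - (1 + i) * w * x * y + x ^+ 2 * y - i * w * y ^+ 2 - x * y ^+ 2
    + (1 - i) * y ^+ 3.

Definition F12 (R : nzRingType) (i w x y : R) : R :=
    (1 + i) * w - i * x - y - w ^+ 2 - w * x - i * x ^+ 2 - i * x * y
    + i * y ^+ 2 + i * w ^+ 3 - (1 + i) * w * x ^+ 2 + i * x ^+ 3
    - i * w ^+ 2 * y - w * x * y + (1 - i) * w * y ^+ 2 + (1 + i) * y ^+ 3.

Definition H100 (R : nzRingType) (i x y : R) : R :=
    - 1 - (1 - i) * x - (1 - i) * x ^+ 2 - (1 + i) * y ^+ 2 - i * x ^+ 3
    - (1 - i) * x * y ^+ 2 + x ^+ 4 - (1 - i) * x ^+ 3 * y
    + (1 + i) * x ^+ 2 * y ^+ 2 + (1 + i) * x * y ^+ 3 - (1 - i) * y ^+ 4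
    - (1 - i) * x ^+ 5 + (1 + i) * x ^+ 4 * y - (1 - i) * x ^+ 3 * y ^+ 2
    - i * x ^+ 2 * y ^+ 3 - i * x * y ^+ 4 + i * y ^+ 5 + i * x ^+ 6
    - x ^+ 5 * y - (1 + i) * x ^+ 4 * y ^+ 2 - (1 + i) * x ^+ 3 * y ^+ 3
    + (1 + i) * x * y ^+ 5 + (1 - i) * y ^+ 6.

Definition H101 (R : nzRingType) (i x y : R) : R :=
    (1 + i) + x + (1 - i) * y - i * x ^+ 2 - (1 + i) * x * y + i * y ^+ 2
    + i * x ^+ 3 - x ^+ 2 * y - i * x * y ^+ 2 + y ^+ 3 + x ^+ 3 * y
    + (1 - i) * x ^+ 2 * y ^+ 2 - (1 - i) * x * y ^+ 3 + (1 - i) * y ^+ 4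
    + x ^+ 5 + i * x ^+ 4 * y + x ^+ 3 * y ^+ 2 - i * x ^+ 2 * y ^+ 3
    + (1 - i) * x * y ^+ 4 - (1 - i) * y ^+ 5.

Definition H102 (R : nzRingType) (i x y : R) : R :=
    i + x + (1 + i) * y + x ^+ 2 + (1 + i) * y ^+ 2 + (1 + i) * x ^+ 3
    - x ^+ 2 * y - (1 + i) * x * y ^+ 2 + i * y ^+ 3 + (1 + i) * x ^+ 4
    + (1 - i) * x ^+ 2 * y ^+ 2 + x * y ^+ 3 + (1 + i) * y ^+ 4.

Definition H103 (R : nzRingType) (i x y : R) : R :=
    (1 - i) - (1 - i) * x + (1 - i) * y - (1 + i) * x ^+ 2 - (1 - i) * x * y
    + (1 + i) * x ^+ 3 - (1 + i) * y ^+ 3.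

Definition H10 (R : nzRingType) (i w x y : R) : R :=
  H100 i x y + H101 i x y * w + H102 i x y * w ^+ 2 + H103 i x y * w ^+ 3.

Definition H110 (R : nzRingType) (i x y : R) : R :=
    - i + i * x + y - (1 + i) * x ^+ 2 + x * y - (1 - i) * y ^+ 2 - x ^+ 3
    - (1 - i) * x ^+ 2 * y + (1 + i) * x * y ^+ 2 - y ^+ 3 + (1 + i) * x ^+ 4
    - i * x ^+ 3 * y - (1 - i) * x ^+ 2 * y ^+ 2 + x * y ^+ 3
    + (1 - i) * y ^+ 4 - (1 + i) * x ^+ 5 + (1 - i) * x ^+ 4 * y
    + i * x ^+ 2 * y ^+ 3 - (1 + i) * x * y ^+ 4 - (1 + i) * y ^+ 5
    - i * x ^+ 6 + (1 + i) * x ^+ 4 * y ^+ 2 + (1 + i) * x ^+ 3 * y ^+ 3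
    + (1 - i) * x * y ^+ 5 - (1 - i) * y ^+ 6.

Definition H111 (R : nzRingType) (i x y : R) : R :=
    - (1 - i) + x + (1 + i) * y - (1 + i) * x ^+ 2 - i * x * y - i * y ^+ 2
    + (1 - i) * x ^+ 3 - i * x ^+ 2 * y - y ^+ 3 + (1 + i) * x ^+ 4
    + (1 - i) * x ^+ 3 * y - x ^+ 2 * y ^+ 2 + (1 + i) * x * y ^+ 3
    - i * y ^+ 4 + (1 - i) * x ^+ 5 + i * x ^+ 4 * y
    + (1 - i) * x ^+ 2 * y ^+ 3 + (1 - i) * x * y ^+ 4 - y ^+ 5.

Definition H112 (R : nzRingType) (i x y : R) : R :=
    - 1 + (1 + i) * y + x ^+ 2 - (1 - i) * x * y - (1 + i) * y ^+ 2
    - x ^+ 2 * y + (1 + i) * x * y ^+ 2 - (1 + i) * y ^+ 3 + (1 - i) * x ^+ 4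
    + (1 + i) * x ^+ 3 * y - (1 + i) * x ^+ 2 * y ^+ 2 - x * y ^+ 3
    - (1 + i) * y ^+ 4.

Definition H113 (R : nzRingType) (i x y : R) : R :=
    (1 + i) - x + y + x ^+ 2 - i * y ^+ 2 - (1 - i) * x ^+ 3 + i * x ^+ 2 * y
    - (1 - i) * x * y ^+ 2 - i * y ^+ 3.

Definition H11 (R : nzRingType) (i w x y : R) : R :=
  H110 i x y + H111 i x y * w + H112 i x y * w ^+ 2 + H113 i x y * w ^+ 3.

Definition H120 (R : nzRingType) (i x y : R) : R :=
    (1 + i) + (1 + i) * x + (1 + i) * y + (1 - i) * x ^+ 2 + y ^+ 2
    + (1 + i) * x ^+ 3 + (1 + i) * x ^+ 2 * y - i * x * y ^+ 2 - y ^+ 3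
    - (1 - i) * x ^+ 3 * y + (1 - i) * x ^+ 2 * y ^+ 2 - (1 + i) * x * y ^+ 3
    + (1 - i) * y ^+ 4 + (1 - i) * x ^+ 5 - i * x ^+ 4 * y
    + (1 - i) * x ^+ 3 * y ^+ 2 - (1 + i) * x ^+ 2 * y ^+ 3 + i * x * y ^+ 4
    - y ^+ 5 + x ^+ 6 - (1 + i) * x ^+ 5 * y - (1 - i) * x ^+ 4 * y ^+ 2
    + x ^+ 3 * y ^+ 3 - i * x ^+ 2 * y ^+ 4 - (1 - i) * x * y ^+ 5
    + (1 - i) * y ^+ 6.

Definition H121 (R : nzRingType) (i x y : R) : R :=
    i + x + x * y - (1 + i) * y ^+ 2 + x ^+ 3 - (1 + i) * x ^+ 2 * y
    - (1 - i) * x * y ^+ 2 + (1 + i) * y ^+ 3 + x ^+ 4 - (1 - i) * x ^+ 3 * y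
    - (1 - i) * x ^+ 2 * y ^+ 2 + (1 + i) * x * y ^+ 3 - (1 - i) * y ^+ 4
    - (1 - i) * x ^+ 5 + (1 + i) * x ^+ 3 * y ^+ 2 + (1 + i) * x ^+ 2 * y ^+ 3
    + (1 - i) * y ^+ 5.

Definition H122 (R : nzRingType) (i x y : R) : R :=
    (1 - i) - x - (1 + i) * y + i * x ^+ 2 - (1 - i) * x * y
    - (1 + i) * y ^+ 2 - x ^+ 3 - (1 - i) * x * y ^+ 2 - i * y ^+ 3
    - (1 + i) * x ^+ 4 - (1 - i) * x ^+ 3 * y - (1 + i) * x ^+ 2 * y ^+ 2
    - x * y ^+ 3 + (1 + i) * y ^+ 4.

Definition H123 (R : nzRingType) (i x y : R) : R :=
    1 - (1 + i) * x + (1 - i) * y + x ^+ 2 + i * x * y + i * y ^+ 2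
    - (1 + i) * x ^+ 3 + (1 - i) * x ^+ 2 * y - (1 + i) * x * y ^+ 2
    + (1 + i) * y ^+ 3.

Definition H12 (R : nzRingType) (i w x y : R) : R :=
  H120 i x y + H121 i x y * w + H122 i x y * w ^+ 2 + H123 i x y * w ^+ 3.

Definition H130 (R : nzRingType) (i x y : R) : R :=
    - (1 - i) + i * x + (1 + i) * y - (1 + i) * x ^+ 2 + (1 - i) * x * y
    + (1 - i) * y ^+ 2 + x ^+ 3 - (1 + i) * x ^+ 2 * y + i * x * y ^+ 2
    + i * y ^+ 3 - (1 + i) * x ^+ 4 + i * x ^+ 3 * y + x ^+ 2 * y ^+ 2
    - (1 + i) * y ^+ 4 + (1 + i) * x ^+ 5 - (1 - i) * x ^+ 4 * y
    + (1 - i) * x ^+ 3 * y ^+ 2 - x ^+ 2 * y ^+ 3 - (1 + i) * y ^+ 5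
    - (1 + i) * x ^+ 6 - (1 - i) * x ^+ 5 * y - (1 + i) * x ^+ 4 * y ^+ 2
    + i * x ^+ 3 * y ^+ 3 + i * x ^+ 2 * y ^+ 4 + i * x * y ^+ 5
    + (1 + i) * y ^+ 6.

Definition H131 (R : nzRingType) (i x y : R) : R :=
    - 1 - x + (1 + i) * y - (1 - i) * x ^+ 2 + (1 + i) * x * y - i * y ^+ 2
    - (1 + i) * x ^+ 3 - i * x ^+ 2 * y - x * y ^+ 2 + i * y ^+ 3 - x ^+ 4
    - x ^+ 3 * y + x * y ^+ 3 - (1 + i) * y ^+ 4 - (1 + i) * x ^+ 5
    + x ^+ 4 * y + (1 - i) * x ^+ 3 * y ^+ 2 - i * x ^+ 2 * y ^+ 3
    + (1 + i) * x * y ^+ 4.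

Definition H132 (R : nzRingType) (i x y : R) : R :=
    (1 + i) + i * x + y - x ^+ 2 + x * y + y ^+ 2 + i * x ^+ 3
    - (1 - i) * x ^+ 2 * y - (1 + i) * x * y ^+ 2 - (1 - i) * x ^+ 4
    - x ^+ 2 * y ^+ 2 - i * x * y ^+ 3 - (1 - i) * y ^+ 4.

Definition H133 (R : nzRingType) (i x y : R) : R :=
    i - y + x ^+ 2 + (1 + i) * x * y - (1 - i) * y ^+ 2.

Definition H13 (R : nzRingType) (i w x y : R) : R :=
  H130 i x y + H131 i x y * w + H132 i x y * w ^+ 2 + H133 i x y * w ^+ 3.

Section InvolutionG1.
Variables (k : fieldType) (i : k).

Definition F1 (w x y : k) : 'rV[k]_3 :=
  \row_(j < 3) [:: F10 i w x y; F11 i w x y; F12 i w x y]`_j.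

Definition H1 (w x y : k) : 'rV[k]_4 :=
  \row_(j < 4) [:: H10 i w x y; H11 i w x y; H12 i w x y; H13 i w x y]`_j.

Definition is_g1 (g : fermat_quartic k -> fermat_quartic k) : Prop :=
  exists (phi1 : fermat_quartic k -> pspace k 2) (Y1 : kspace k)
         (rho1 : fermat_quartic k -> Y1) (pi1 : Y1 -> pspace k 2)
         (tau : Y1 -> Y1),
    [/\ [/\ kmorphism phi1, induced_by F1 phi1 & has_degree phi1 2],
        stein_factorization phi1 rho1 pi1,
        deck_transformation pi1 tau /\ (exists y, tau y <> y) &
        [/\ kisomorphism g, involutive g &
            forall x, rho1 (g x) = tau (rho1 x)]].

End InvolutionG1.

(* Main.v *)
Require Import Defs.
From mathcomp Require Import all_boot all_order all_algebra.
From mathcomp Require Import boolp classical_sets topology_structure.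
From mathcomp Require Import initial_topology subtype_topology.
From mathcomp Require Import ring mpoly.

(** Write F = (F10, F11, F12), H = (H10, H11, H12, H13), v = (w, x, y, 1), and X
    for the Fermat quartic.

    The involution g satisfies phi1 (g P) = phi1 P, where phi1 is given by F, so
    everything rests on the fibres of F.  There are two forms linear in v,
    plane1 and plane2, and one quadratic in v, quadric, whose coefficients are
    forms of degree 1, 2 and 1 in F, and which vanish identically on X both at v
    and when v is replaced by H.  Since the coefficients are forms in F, they
    also vanish at every other point of the fibre through v.  A fibre is thus
    contained in the intersection of a line with a quadric, of which v and H are
    two points; where the planes are independent and v and H are not conjugate
    with respect to the quadric, the intersection consists of these two points
    (line_quadric_points), so g P is P or the point H (fibre_points).

    To pass from this dichotomy to g P = H wherever H does not vanish, two facts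
    are needed.  First, g is not the identity: the deck transformation tau is
    not, and if a regular function e separates y from tau y then e o tau - e is
    nonzero, hence does not vanish on the whole image of X
    (deck_transformation_moves).  Second, X is irreducible (fermat_open_meet):
    the nonempty open sets where g P is not P, where g P is not H, and where the
    dichotomy holds would have a common point.

    Irreducibility comes from the unirationality of X in characteristic 3.  After
    a change of coordinates over F_9 the equation is
    p ^+ 3 * q + p * q ^+ 3 + r ^+ 3 * s + r * s ^+ 3 = 0, and adjoining the cube
    root of r / q makes the surface rational.  The resulting map from the plane
    (param) covers an explicit open subset (param_surj), which is dense
    (param_range_dense): over a suitable line of the plane with coordinates
    x, y, z, all but finitely many points of the curve w ^+ 4 = - (x ^+ 4 +
    y ^+ 4 + z ^+ 4) lie in it, and a polynomial of degree less than 4 in w that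
    vanishes at these points is zero.  Two points in the image of the plane are
    joined by the image of a line.

    The vanishing on X of the fibre equations is checked by computing normal
    forms of polynomials over F_9 modulo the equation of X (eval_eq0), and the
    genericity conditions are checked at the point (0, 0, - (1 + i)). *)

Set Implicit Arguments.
Unset Strict Implicit.
Unset Printing Implicit Defensive.

Import GRing.Theory.
Local Open Scope classical_set_scope.
Local Open Scope ring_scope.

(** * Computing with polynomials over F_9 modulo the Fermat quartic *)

(** Polynomial expressions over F_9 in the affine coordinates w, x, y. *)
Inductive expr :=
  | EOne | EI | EW | EX | EY
  | EAdd of expr & expr | EOpp of expr | EMul of expr & expr
  | EExp of expr & nat.

Fixpoint eval (R : nzRingType) (i w x y : R) (e : expr) : R :=
  match e with
  | EOne => 1 | EI => i | EW => w | EX => x | EY => y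
  | EAdd a b => eval i w x y a + eval i w x y b
  | EOpp a => - eval i w x y a
  | EMul a b => eval i w x y a * eval i w x y b
  | EExp a n => eval i w x y a ^+ n
  end.

(** The expression denoting a given term of a ring. *)
Ltac reify i w x y t :=
  lazymatch t with
  | i => EI | w => EW | x => EX | y => EY
  | @GRing.one _ => EOne
  | @GRing.add _ ?a ?b =>
      let a' := reify i w x y a in let b' := reify i w x y b in
      constr:(EAdd a' b')
  | @GRing.opp _ ?a => let a' := reify i w x y a in constr:(EOpp a')
  | @GRing.mul _ ?a ?b =>
      let a' := reify i w x y a in let b' := reify i w x y b in
      constr:(EMul a' b')
  | @GRing.exp _ ?a ?n => let a' := reify i w x y a in constr:(EExp a' n)
  end.

(** Coefficient rings with enough structure to compute in, together with their
    interpretation in a commutative ring. *)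
Record coefs (R : comNzRingType) := Coefs {
  csort :> Type;
  czero : csort;
  cone : csort;
  cadd : csort -> csort -> csort;
  copp : csort -> csort;
  cmul : csort -> csort -> csort;
  ciszero : csort -> bool;
  cval : csort -> R;
  cval0 : cval czero = 0;
  cval1 : cval cone = 1;
  cvalD : forall a b, cval (cadd a b) = cval a + cval b;
  cvalN : forall a, cval (copp a) = - cval a;
  cvalM : forall a b, cval (cmul a b) = cval a * cval b;
  ciszeroP : forall a, ciszero a -> cval a = 0
}.

(** Univariate polynomials over such a ring, as lists of coefficients, lowest
    degree first, evaluated at [t]. *)
Section ListPolynomials.
Variables (R : comNzRingType) (C : coefs R) (t : R).

Definition lval (p : seq C) : R := foldr (fun a s => cval a + t * s) 0 p.

Fixpoint ladd (p q : seq C) : seq C :=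
  match p, q with
  | [::], _ => q
  | _, [::] => p
  | a :: p', b :: q' => cadd a b :: ladd p' q'
  end.

Fixpoint lmul (p q : seq C) : seq C :=
  if p is a :: p' then ladd (map (cmul a) q) (czero C :: lmul p' q) else [::].

Lemma lvalD p q : lval (ladd p q) = lval p + lval q.
Proof.
elim: p q => [|a p IH] [|b q] /=; rewrite ?add0r ?addr0 //.
by rewrite cvalD IH; ring.
Qed.

Lemma lvalN p : lval (map (@copp R C) p) = - lval p.
Proof. by elim: p => [|a p IH] /=; rewrite ?oppr0 // cvalN IH; ring. Qed.

Lemma lvalM p q : lval (lmul p q) = lval p * lval q.
Proof.
have lvalZ a : lval (map (cmul a) q) = cval a * lval q.
  by elim: q => [|b q' IH] /=; rewrite ?mulr0 // cvalM IH; ring.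
elim: p => [|a p IH] /=; first by rewrite mul0r.
by rewrite lvalD lvalZ /= cval0 IH; ring.
Qed.

Lemma lval0P p : all (@ciszero R C) p -> lval p = 0.
Proof.
by elim: p => //= a p IH /andP[/ciszeroP-> /IH->]; rewrite mulr0 addr0.
Qed.

Lemma lval1 : lval [:: cone C] = 1.
Proof. by rewrite /= cval1 mulr0 addr0. Qed.

Definition lcoefs : coefs R :=
  Coefs (erefl : lval [::] = 0) lval1 lvalD lvalN lvalM lval0P.

End ListPolynomials.

(** The prime field F_3, and F_9 as pairs (a, b) standing for a + b i. *)
Inductive trit := T0 | T1 | T2.

Definition tadd a b := match a, b with
  | T0, c | c, T0 => c | T1, T1 => T2 | T2, T2 => T1 | _, _ => T0 end.
Definition topp a := match a with T0 => T0 | T1 => T2 | T2 => T1 end.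
Definition tmul a b := match a, b with
  | T0, _ | _, T0 => T0 | T1, c | c, T1 => c | T2, T2 => T1 end.

Definition f9 : Type := trit * trit.
Definition f9add (a b : f9) : f9 := (tadd a.1 b.1, tadd a.2 b.2).
Definition f9opp (a : f9) : f9 := (topp a.1, topp a.2).
Definition f9mul (a b : f9) : f9 :=
  (tadd (tmul a.1 b.1) (topp (tmul a.2 b.2)),
   tadd (tmul a.1 b.2) (tmul a.2 b.1)).
Definition f9iszero (a : f9) : bool :=
  match a with (T0, T0) => true | _ => false end.

Section Char3.
Variables (k : fieldType) (char3 : 3%N \in [pchar k]).
Variables (i : k) (sqr_i : i ^+ 2 = -1).

Lemma three_eq0 : 3%:R = 0 :> k.
Proof. exact: pcharf0. Qed.

Definition tval (a : trit) : k := match a with T0 => 0 | T1 => 1 | T2 => -1 end.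
Definition f9val (a : f9) : k := tval a.1 + tval a.2 * i.

Lemma addr_1_1 : 1 + 1 = -1 :> k.
Proof. by apply/eqP; rewrite -subr_eq0 opprK -addrA -three_eq0 !mulrS mulr0n addr0. Qed.

Lemma tvalD a b : tval (tadd a b) = tval a + tval b.
Proof.
by case: a; case: b; rewrite /= ?addr0 ?add0r ?subrr ?addNr -?opprD ?addr_1_1 ?opprK.
Qed.

Lemma tvalN a : tval (topp a) = - tval a.
Proof. by case: a; rewrite /= ?oppr0 ?opprK. Qed.

Lemma tvalM a b : tval (tmul a b) = tval a * tval b.
Proof. by case: a; case: b; rewrite /= ?mulr0 ?mul0r ?mul1r ?mulr1 ?mulrNN ?mulr1. Qed.

Lemma f9valD a b : f9val (f9add a b) = f9val a + f9val b.
Proof. by rewrite /f9val !tvalD; ring. Qed.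

Lemma f9valN a : f9val (f9opp a) = - f9val a.
Proof. by rewrite /f9val !tvalN; ring. Qed.

Lemma f9valM a b : f9val (f9mul a b) = f9val a * f9val b.
Proof.
rewrite /f9val !tvalD !tvalN !tvalM.
by ring: sqr_i.
Qed.

Lemma f9val0 : f9val (T0, T0) = 0.
Proof. by rewrite /f9val /= mul0r addr0. Qed.

Lemma f9val1 : f9val (T1, T0) = 1.
Proof. by rewrite /f9val /= mul0r addr0. Qed.

Lemma f9iszeroP a : f9iszero a -> f9val a = 0.
Proof. by case: a => [[] []] //= _; apply: f9val0. Qed.

Lemma f9val_neq0 a : ~~ f9iszero a -> f9val a != 0.
Proof.
have i0 : i != 0.
  by apply/eqP => i0; move/eqP: sqr_i; rewrite i0 expr0n eq_sym oppr_eq0 oner_eq0.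
(* The norm of a + b i is a ^+ 2 + b ^+ 2, which is 1 or 2 for a, b in F_3 not
   both zero. *)
move=> a0; apply/eqP => aE.
have: f9val (f9mul a (a.1, topp a.2)) = 0 by rewrite f9valM aE mul0r.
have e1 : 1 <> 0 :> k by apply/eqP/oner_neq0.
case: a a0 {aE} => [[] []] //= _; rewrite /f9val /= ?mul0r ?addr0 //;
  by move/eqP; rewrite oppr_eq0 => /eqP.
Qed.

Definition f9coefs : coefs k :=
  Coefs f9val0 f9val1 f9valD f9valN f9valM f9iszeroP.

Variables (w x y : k).

(** Polynomials in w with coefficients in F_9[y][x]. *)
Definition poly_y : coefs k := lcoefs f9coefs y.
Definition poly_xy : coefs k := lcoefs poly_y x.
Definition poly_wxy : coefs k := lcoefs poly_xy w.

(** The polynomial - (x ^+ 4 + y ^+ 4 + 1). *)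
Definition fermat_rhs : poly_xy :=
  let z := czero poly_y in
  copp ([:: [:: (T1, T0); (T0, T0); (T0, T0); (T0, T0); (T1, T0)];
            z; z; z; cone poly_y] : poly_xy).

(** Reduction of the powers of w modulo w ^+ 4 = fermat_rhs. *)
Fixpoint fermat_reduce (p : seq poly_xy) : seq poly_xy :=
  if p is a :: p' then
    match fermat_reduce p' with
    | [:: r0; r1; r2; r3] => [:: cadd a (cmul fermat_rhs r3); r0; r1; r2]
    | r => a :: r
    end
  else [::].

(** The representative of degree at most 3 in w, computed by reducing after every
    multiplication. *)
Fixpoint normal_form (e : expr) : poly_wxy :=
  match e with
  | EOne => cone poly_wxy
  | EI => [:: [:: [:: (T0, T1)]]]
  | EW => [:: czero poly_xy; cone poly_xy]
  | EX => [:: [:: czero poly_y; cone poly_y]]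
  | EY => [:: [:: [:: (T0, T0); (T1, T0)]]]
  | EAdd a b => cadd (normal_form a) (normal_form b)
  | EOpp a => copp (normal_form a)
  | EMul a b => fermat_reduce (cmul (normal_form a) (normal_form b))
  | EExp a n => iter n (fun p => fermat_reduce (cmul (normal_form a) p))
                       (cone poly_wxy)
  end.

Hypothesis wxyX : w ^+ 4 + x ^+ 4 + y ^+ 4 + 1 = 0.

Lemma fermat_reduceE (p : poly_wxy) :
  cval (fermat_reduce p : poly_wxy) = cval p.
Proof.
have rhsE : cval fermat_rhs = w ^+ 4.
  rewrite /fermat_rhs cvalN /= !f9val0 !f9val1.
  by apply: (addIr (x ^+ 4 + y ^+ 4 + 1)); rewrite !addrA wxyX; ring.
elim: p => [//|a p IH].
have {}IH : lval w (fermat_reduce p) = lval w p by exact: IH.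
rewrite -[RHS]/(cval a + w * lval w p) -{}IH.
rewrite -[LHS]/(lval w (fermat_reduce (a :: p))) [fermat_reduce (a :: p)]/=.
case: (fermat_reduce p) => [|r0 [|r1 [|r2 [|r3 [|r4 s]]]]] //.
rewrite -[LHS]/(cval (cadd a (cmul fermat_rhs r3)) + w * (cval r0 +
  w * (cval r1 + w * (cval r2 + w * 0)))) -[RHS]/(cval a + w * (cval r0 +
  w * (cval r1 + w * (cval r2 + w * (cval r3 + w * 0))))) cvalD cvalM rhsE.
by ring.
Qed.

Lemma normal_formE e : cval (normal_form e) = eval i w x y e.
Proof.
elim: e => /= [|||||a IHa b IHb|a IHa|a IHa b IHb|a IHa n].
- exact: (@cval1 _ poly_wxy).
- by rewrite /f9val /=; ring.
- by rewrite !f9val1; ring.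
- by rewrite !f9val1; ring.
- by rewrite !f9val0 !f9val1; ring.
- by rewrite -IHa -IHb; exact: (@cvalD _ poly_wxy).
- by rewrite -IHa; exact: (@cvalN _ poly_wxy).
- by rewrite -IHa -IHb -[RHS](@cvalM _ poly_wxy); exact: fermat_reduceE.
- elim: n => [|n IHn]; first exact: (@cval1 _ poly_wxy).
  rewrite -[RHS]/(eval i w x y a ^+ n.+1) [RHS]exprS.
  rewrite -[X in X * _]IHa -[X in _ * X]IHn -[RHS](@cvalM _ poly_wxy).
  exact: fermat_reduceE.
Qed.

Lemma eval_eq0 e : ciszero (normal_form e) -> eval i w x y e = 0.
Proof. by rewrite -normal_formE; apply: ciszeroP. Qed.

End Char3.

(** * The fibres of the degree-two map *)

(** Two plane sections and a quadric, with coefficients depending on a point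
    [a : b : c] of the plane: on X they all contain the fibre over
    [a : b : c] = [F10 : F11 : F12], so that this fibre lies on the intersection
    of a line and a quadric. *)
Section FibreEquations.
Variables (R : nzRingType) (i a b c : R).

Definition plane1w := - (1 - i) * c - (1 + i) * b.
Definition plane1x := a + (1 - i) * c - i * b.
Definition plane1y := - c + (1 + i) * a + (1 + i) * b.
Definition plane1z := - (1 + i) * b + (1 - i) * a.
Definition plane2w := a ^+ 2 - i * a * c.
Definition plane2x := - c ^+ 2 + b ^+ 2 + a * c + a * b - a ^+ 2.
Definition plane2y := - i * a * c - (1 + i) * a ^+ 2.
Definition plane2z := - (1 - i) * c ^+ 2 + (1 - i) * (b ^+ 2 + a * c + a * b).

Definition plane1 (w x y z : R) :=
  plane1w * w + plane1x * x + plane1y * y + plane1z * z.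

Definition plane2 (w x y z : R) :=
  plane2w * w + plane2x * x + plane2y * y + plane2z * z.

Definition quadric (w x y z : R) :=
  a * ((1 - i) * y * z - (1 - i) * y ^+ 2 + (1 + i) * x * z + (1 - i) * x * y
       + x ^+ 2 + w * z - i * w * y + (1 - i) * w * x - (1 + i) * w ^+ 2)
  + b * (i * y ^+ 2 + w * y + i * w ^+ 2)
  + c * (- z ^+ 2 + (1 + i) * y * z - x * z + x ^+ 2 + (1 - i) * w * x).

(** The polar form of the quadric. *)
Definition polar (w x y z w' x' y' z' : R) :=
  quadric (w + w') (x + x') (y + y') (z + z')
  - quadric w x y z - quadric w' x' y' z'.

(** The coefficient of the line cut out by the two planes that allows w and x
    to be recovered from y and z. *)
Definition planes_minor := plane1w * plane2x - plane1x * plane2w.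

End FibreEquations.

(** A line meets a quadric in at most two points: if v and v' are on both and
    not conjugate with respect to the quadric, any further point u of the
    intersection is proportional to one of them. *)
Lemma line_quadric_points (k : fieldType) (i a b c w x y z w' x' y' z'
    uw ux uy uz : k) :
  plane1 i a b c w x y z = 0 -> plane2 i a b c w x y z = 0 ->
  quadric i a b c w x y z = 0 ->
  plane1 i a b c w' x' y' z' = 0 -> plane2 i a b c w' x' y' z' = 0 ->
  quadric i a b c w' x' y' z' = 0 ->
  plane1 i a b c uw ux uy uz = 0 -> plane2 i a b c uw ux uy uz = 0 ->
  quadric i a b c uw ux uy uz = 0 ->
  planes_minor i a b c != 0 -> y * z' - z * y' != 0 ->
  polar i a b c w x y z w' x' y' z' != 0 ->
  exists s, [/\ uw = s * w, ux = s * x, uy = s * y & uz = s * z] \/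
            [/\ uw = s * w', ux = s * x', uy = s * y' & uz = s * z'].
Proof.
move=> v1 v2 vq v1' v2' vq' u1 u2 uq m0 d0 p0.
set d := y * z' - z * y' in d0.
pose al := uy * z' - uz * y'; pose be := y * uz - z * uy.
have [duy duz] : d * uy = al * y + be * y' /\ d * uz = al * z + be * z'.
  by rewrite /d /al /be; split; ring.
have duw : d * uw = al * w + be * w'.
  apply: (mulfI m0); apply/eqP; rewrite -subr_eq0; apply/eqP.
  transitivity (plane2x a b c * (d * plane1 i a b c uw ux uy uz
      - al * plane1 i a b c w x y z - be * plane1 i a b c w' x' y' z')
    - plane1x i a b c * (d * plane2 i a b c uw ux uy uz
      - al * plane2 i a b c w x y z - be * plane2 i a b c w' x' y' z')).
    by rewrite /planes_minor /plane1 /plane2 /al /be /d; ring.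
  by rewrite v1 v2 v1' v2' u1 u2; ring.
have dux : d * ux = al * x + be * x'.
  apply: (mulfI m0); apply/eqP; rewrite -subr_eq0; apply/eqP.
  transitivity (plane1w i b c * (d * plane2 i a b c uw ux uy uz
      - al * plane2 i a b c w x y z - be * plane2 i a b c w' x' y' z')
    - plane2w i a c * (d * plane1 i a b c uw ux uy uz
      - al * plane1 i a b c w x y z - be * plane1 i a b c w' x' y' z')).
    by rewrite /planes_minor /plane1 /plane2 /al /be /d; ring.
  by rewrite v1 v2 v1' v2' u1 u2; ring.
have : al * be * polar i a b c w x y z w' x' y' z' = 0.
  transitivity (quadric i a b c (d * uw) (d * ux) (d * uy) (d * uz)).
    rewrite duw dux duy duz.
    transitivity (al ^+ 2 * quadric i a b c w x y z
      + al * be * polar i a b c w x y z w' x' y' z'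
      + be ^+ 2 * quadric i a b c w' x' y' z').
      by rewrite vq vq'; ring.
    by rewrite /polar /quadric; ring.
  transitivity (d ^+ 2 * quadric i a b c uw ux uy uz).
    by rewrite /quadric; ring.
  by rewrite uq mulr0.
have solve s t t' u : d * u = s * t + 0 * t' -> u = s / d * t.
  by move=> e; apply: (mulfI d0); rewrite e; field.
move/eqP; rewrite !mulf_eq0 (negPf p0) orbF => /orP[] /eqP e0.
- exists (be / d); right; move: duw dux duy duz; rewrite e0.
  by split; apply: (solve _ _ 0); rewrite mul0r addr0 ?duw ?dux ?duy ?duz ?mul0r ?add0r.
- exists (al / d); left; move: duw dux duy duz; rewrite e0.
  by split; apply: (solve _ _ 0); rewrite mul0r addr0 ?duw ?dux ?duy ?duz ?mul0r ?addr0.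
Qed.

(** Unfolding down to ring operations on i, w, x, y. *)
Local Ltac expand := rewrite /polar /planes_minor /plane1 /plane2 /plane1w
  /plane1x /plane1y /plane1z /plane2w /plane2x /plane2y /plane2z /quadric
  /F10 /F11 /F12 /H10 /H11 /H12 /H13
  /H100 /H101 /H102 /H103 /H110 /H111 /H112 /H113
  /H120 /H121 /H122 /H123 /H130 /H131 /H132 /H133.

(** The fibre equations hold at every point of X, and at its image under
    [H10 : H11 : H12 : H13]. *)
Section FermatIdentities.
Variables (k : fieldType) (char3 : 3%N \in [pchar k]).
Variables (i : k) (sqr_i : i ^+ 2 = -1) (w x y : k).

Local Ltac fermat_ring h :=
  expand;
  lazymatch goal with |- ?t = 0 =>
    let e := reify i w x y t in
    change (eval i w x y e = 0); refine (@eval_eq0 _ char3 _ sqr_i _ _ _ h e _);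
    vm_compute; reflexivity
  end.

Local Notation F t := (t (F10 i w x y) (F11 i w x y) (F12 i w x y)).

Lemma plane1_fibre : w ^+ 4 + x ^+ 4 + y ^+ 4 + 1 = 0 ->
  F (plane1 i) w x y 1 = 0.
Proof. by move=> h; fermat_ring h. Qed.

Lemma plane2_fibre : w ^+ 4 + x ^+ 4 + y ^+ 4 + 1 = 0 ->
  F (plane2 i) w x y 1 = 0.
Proof. by move=> h; fermat_ring h. Qed.

Lemma quadric_fibre : w ^+ 4 + x ^+ 4 + y ^+ 4 + 1 = 0 ->
  F (quadric i) w x y 1 = 0.
Proof. by move=> h; fermat_ring h. Qed.

Local Notation H t :=
  (F t (H10 i w x y) (H11 i w x y) (H12 i w x y) (H13 i w x y)).

Lemma plane1_conjugate : w ^+ 4 + x ^+ 4 + y ^+ 4 + 1 = 0 ->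
  H (plane1 i) = 0.
Proof. by move=> h; fermat_ring h. Qed.

Lemma plane2_conjugate : w ^+ 4 + x ^+ 4 + y ^+ 4 + 1 = 0 ->
  H (plane2 i) = 0.
Proof. by move=> h; fermat_ring h. Qed.

Lemma quadric_conjugate : w ^+ 4 + x ^+ 4 + y ^+ 4 + 1 = 0 ->
  H (quadric i) = 0.
Proof. by move=> h; fermat_ring h. Qed.

End FermatIdentities.

(** * Regular functions on spaces with functions *)

Section RegularFunctions.
Variables (k : fieldType) (S : kspace k).
Implicit Types (U : set S) (f g : S -> k).

Lemma regular_opp U f : open U -> regular U f -> regular U (fun x => - f x).
Proof.
move=> oU Uf; apply: (regular_eq oU (f := fun x => 0 - f x)).
  by move=> x _; rewrite sub0r.
by apply: regular_sub => //; apply: regular_cst.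
Qed.

Lemma regular_add U f g : open U -> regular U f -> regular U g ->
  regular U (fun x => f x + g x).
Proof.
move=> oU Uf Ug; apply: (regular_eq oU (f := fun x => f x - - g x)).
  by move=> x _; rewrite opprK.
by apply: regular_sub => //; apply: regular_opp.
Qed.

Lemma regular_exp U f n : open U -> regular U f ->
  regular U (fun x => f x ^+ n).
Proof.
move=> oU Uf; elim: n => [|n IHn]; first exact: (regular_cst 1 oU).
apply: (regular_eq oU (f := fun x => f x * f x ^+ n)).
  by move=> x _; rewrite exprS.
exact: regular_mul.
Qed.

Lemma regular_eval U (i : k) f g h e : open U ->
  regular U f -> regular U g -> regular U h ->
  regular U (fun x => eval i (f x) (g x) (h x) e).
Proof.
move=> oU Uf Ug Uh; elim: e => //= [||a IHa b IHb|a IHa|a IHa b IHb|a IHa n].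
- exact: (regular_cst 1 oU).
- exact: (regular_cst i oU).
- exact: (regular_add oU IHa IHb).
- exact: (regular_opp oU IHa).
- exact: (regular_mul oU IHa IHb).
- exact: (regular_exp n oU IHa).
Qed.

(** A regular function on an open subspace, extended by zero, is regular there
    as a function on the whole space. *)
Lemma regular_extension U (f : ksub U -> k) : open U -> regular setT f ->
  exists2 g : S -> k, regular U g & forall x : set_type U, g (\val x) = f x.
Proof.
move=> oU rf.
pose g x := if pselect (x \in U) is left xU then f (exist _ x xU) else 0.
have gE (x : set_type U) : g (\val x) = f x.
  rewrite /g; case: pselect => [xU|/(_ (valP x))//].
  by congr f; apply: val_inj.
exists g => //; apply: regular_glue => // x Ux.
have [V [h [oV Vx rh fh]]] := rf (exist _ x (mem_set Ux)) I.
have oVU : open (V `&` U) by apply: openI.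
exists (V `&` U); split=> //.
apply: (regular_eq oVU (f := h)); last first.
  by apply: (regular_restr oV oVU _ rh) => z [].
move=> z [Vz Uz]; rewrite -(fh (exist _ z (mem_set Uz)) I Vz).
by rewrite -gE.
Qed.

End RegularFunctions.

(** Two points of the same fibre of the finite morphism of a Stein factorization
    are separated by a regular function, a coordinate of an affine chart, and
    regular functions on the middle space are determined by their pullbacks.
    So a nontrivial deck transformation moves some point of the image. *)
Lemma deck_transformation_moves (k : fieldType) (S Y T : kspace k)
    (f : S -> T) (rho : S -> Y) (pi : Y -> T) (tau : Y -> Y) (y : Y) :
  stein_factorization f rho pi -> deck_transformation pi tau -> tau y <> y ->
  exists x, tau (rho x) <> rho x.
Proof.
move=> [_ pfs [[pi_cont _] fin] _] [[_ [[tau_cont tau_reg] _ _ _]] pi_tau] tauy.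
apply/existsNP => tau_id; apply: tauy.
have [V [oV Vy _ [n [Z [_ [h [h' [[_ h_reg] _ hK _]]]]]] _]] := fin (pi y).
pose W := pi @^-1` V.
have oW : open W by move/continuousP : pi_cont; apply.
have Wy : y \in W by apply: mem_set.
have Wty : tau y \in W by apply: mem_set; rewrite /W /= pi_tau.
pose y1 : set_type W := exist _ y Wy; pose y2 : set_type W := exist _ (tau y) Wty.
suff : h y2 = h y1 by move=> /(can_inj hK)/(congr1 val).
apply: val_inj; apply/rowP => j.
pose X : aspace k n -> k := fun P => (P : 'rV[k]_n) 0 j.
have X_reg : regular setT X.
  move=> P _; exists 0%N, ('X_j : {mpoly k[n]}), 1; split=> //.
    by rewrite /aeval meval1 oner_neq0.
  by move=> Q _ _; rewrite /aeval meval1 mevalXU divr1.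
have XZ_reg : @regular _ (ksub Z) setT (fun z => X (\val z)).
  by move=> z _; exists setT, X; split=> //; exact: openT.
have [e e_reg eE] := regular_extension oW (h_reg _ _ openT XZ_reg).
have tauW : tau @^-1` W = W by apply/seteqP; split=> z; rewrite /W /= pi_tau.
have et_reg : regular W (e \o tau).
  by rewrite -[X in regular X]tauW; apply: tau_reg.
have [inj _] := pfs W oW.
have := inj _ (regular_sub oW et_reg e_reg).
move=> /(_ _ y (set_mem Wy)) /= H.
have /eqP : e (tau y) - e y = 0.
  by apply: H => x _; rewrite tau_id subrr.
by rewrite subr_eq0 => /eqP; rewrite (eE y1) (eE y2).
Qed.

(** * Homogeneous coordinates *)

Section Lines.
Variables (k : fieldType) (n : nat).
Implicit Types (P : pspace_pt k n) (u v : 'rV[k]_n.+1).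

Lemma pcoord_neq0 P : pcoord P != 0.
Proof. by rewrite /pcoord vpick0 -dimv_eq0 (eqP (valP P)). Qed.

Lemma val_pcoord P : val P = <[pcoord P]>%VS.
Proof.
apply/esym/eqP; rewrite -dimv_leqif_eq; last by rewrite -memvE memv_pick.
by rewrite dim_vline pcoord_neq0 (eqP (valP P)).
Qed.

Lemma pcoord_line P u : val P = <[u]>%VS ->
  exists2 s, s != 0 & pcoord P = s *: u.
Proof.
move=> Pu; have : pcoord P \in <[u]>%VS by rewrite -Pu memv_pick.
move/vlineP => [s e]; exists s => //.
by apply: contraNneq (pcoord_neq0 P) => s0; rewrite e s0 scale0r.
Qed.

Lemma vline_scale s u : s != 0 -> <[s *: u]>%VS = <[u]>%VS.
Proof.
move=> s0; apply/eqP; rewrite eqEsubv -!memvE; apply/andP; split.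
  by apply/vlineP; exists s.
by apply/vlineP; exists s^-1; rewrite scalerA mulVf ?scale1r.
Qed.

Lemma pspace_point u : u != 0 -> exists P : pspace_pt k n, val P = <[u]>%VS.
Proof.
move=> u0; have dim_u : \dim <[u]>%VS == 1%N by rewrite dim_vline u0.
by exists (Sub <[u]>%VS dim_u); rewrite SubK.
Qed.

(** Proportionality of nonzero vectors, in terms of 2 x 2 minors. *)
Lemma pcoord_collinear P v : v != 0 ->
  (val P = <[v]>%VS <->
   forall j l, pcoord P 0 j * v 0 l = pcoord P 0 l * v 0 j).
Proof.
move=> v0; split=> [Pv j l | col].
  have [s _ ->] := pcoord_line Pv.
  by rewrite !mxE; ring.
have /rV0Pn[m vm] := v0.
have e : pcoord P = (pcoord P 0 m / v 0 m) *: v.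
  apply/rowP => l; rewrite mxE; apply: (mulIf vm).
  by rewrite col [RHS]mulrAC divfK // mulrC.
rewrite val_pcoord e vline_scale //; apply: contraNneq (pcoord_neq0 P) => s0.
by rewrite e s0 scale0r.
Qed.

Lemma meval_homog_scale d (p : {mpoly k[n.+1]}) s u : p \is d.-homog ->
  p.@[fun j => (s *: u) 0 j] = s ^+ d * p.@[fun j => u 0 j].
Proof.
move=> hp; rewrite !mevalE mulr_sumr; apply: eq_big_seq => m mp.
rewrite mulrCA; congr (_ * _).
have <- : mdeg m = d := dhomog_mf hp mp.
rewrite mdegE -prodrXr -big_split /=.
by apply: eq_bigr => j _; rewrite mxE exprMn.
Qed.

Lemma peval_neq0 d (p : {mpoly k[n.+1]}) P u : p \is d.-homog ->
  val P = <[u]>%VS -> (peval p P != 0) = (p.@[fun j => u 0 j] != 0).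
Proof.
move=> hp /pcoord_line[s s0 e].
by rewrite /peval e (meval_homog_scale _ _ hp) mulf_eq0 expf_eq0 (negPf s0) andbF.
Qed.

End Lines.

Section FermatCoordinates.
Variable k : fieldType.
Local Notation X := (fermat_quartic k).
Implicit Types (P : X) (u v : 'rV[k]_4).

(** A vector of homogeneous coordinates of a point of X. *)
Definition fermat_coord P : 'rV[k]_4 := pcoord (fermat_incl P).

Lemma fermat_point u : u != 0 -> \sum_(j < 4) u 0 j ^+ 4 = 0 ->
  exists P : X, val (fermat_incl P) = <[u]>%VS.
Proof.
move=> u0 uX; have [L Lu] := pspace_point u0.
have LX : L \in [set P : pspace k 3 | \sum_(j < 4) pcoord P 0 j ^+ 4 = 0].
  apply: mem_set => /=; have [s s0 ->] := pcoord_line Lu.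
  under eq_bigr do rewrite mxE exprMn.
  by rewrite -mulr_sumr uX mulr0.
by exists (exist _ L LX).
Qed.

Lemma fermat_line_eq P u : val (fermat_incl P) = <[u]>%VS ->
  \sum_(j < 4) u 0 j ^+ 4 = 0.
Proof.
move=> /pcoord_line[s s0 e].
have := set_mem (valP P); rewrite /= -[pcoord (\val P)]/(pcoord (fermat_incl P)).
rewrite e; under eq_bigr do rewrite mxE exprMn.
by rewrite -mulr_sumr => /eqP; rewrite mulf_eq0 expf_eq0 (negPf s0) => /eqP.
Qed.

(** The affine chart where the j-th coordinate is nonzero, and the affine
    coordinates on it. *)
Definition chart (j : 'I_4) : set X := [set P | fermat_coord P 0 j != 0].

Definition affine_coord (j l : 'I_4) (P : X) : k :=
  fermat_coord P 0 l / fermat_coord P 0 j.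

Lemma coord_homog (j : 'I_4) : ('X_j : {mpoly k[4]}) \is 1.-homog.
Proof. by rewrite dhomogX /= mdeg1. Qed.

Lemma pspace_coord_open (j : 'I_4) :
  open ([set P | pcoord P 0 j != 0] : set (pspace k 3)).
Proof.
move=> P Pj; exists 1%N, 'X_j; rewrite /peval mevalXU.
by split=> // [|Q]; [exact: coord_homog | rewrite mevalXU].
Qed.

Lemma chart_open j : open (chart j).
Proof. exact: open_sub_preim (@pspace_coord_open j). Qed.

Lemma affine_coord_regular j l : regular (chart j) (affine_coord j l).
Proof.
move=> P Pj; exists [set Q | pcoord Q 0 j != 0],
  (fun Q => pcoord Q 0 l / pcoord Q 0 j); split=> //.
  exact: pspace_coord_open.
move=> Q Qj; exists 1%N, 'X_l, 'X_j; rewrite /peval mevalXU.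
by split=> // [||Q' _ _]; rewrite ?mevalXU //; apply: coord_homog.
Qed.

(** For a morphism g, the locus where the point g P is not on the line spanned by
    a vector of regular functions at P is open. *)
Lemma not_on_line_open (g : X -> X) (U : set X) (u : 'I_4 -> X -> k) :
  kmorphism g -> open U -> (forall l, regular U (u l)) ->
  open (U `&` [set P | exists j l,
    fermat_coord (g P) 0 j * u l P != fermat_coord (g P) 0 l * u j P]).
Proof.
move=> [g_cont g_reg] oU u_reg; apply: open_local => P [UP [j [l Pjl]]].
have /rV0Pn[m Pm] : fermat_coord (g P) != 0 by exact: pcoord_neq0.
pose V := U `&` g @^-1` chart m.
have oV : open V.
  by apply: openI => //; move/continuousP: g_cont; apply; apply: chart_open.
have coord_g j' : regular V (fun P => affine_coord m j' (g P)).
  apply: (regular_restr _ oV (U := g @^-1` chart m)).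
  - by move/continuousP: g_cont; apply; apply: chart_open.
  - by move=> ? [].
  - by apply: g_reg; [apply: chart_open | apply: affine_coord_regular].
have u_V l' : regular V (u l') by apply: regular_restr (u_reg l') => // ? [].
pose f Q := affine_coord m j (g Q) * u l Q - affine_coord m l (g Q) * u j Q.
have f_reg : regular V f by apply: regular_sub => //; apply: regular_mul.
have fE Q : V Q -> (f Q != 0) =
    (fermat_coord (g Q) 0 j * u l Q != fermat_coord (g Q) 0 l * u j Q).
  move=> [_ Qm]; rewrite /f /affine_coord !(mulrAC _ _^-1) -mulrBl mulf_eq0 invr_eq0.
  by rewrite (negPf Qm) orbF subr_eq0.
exists (V `&` [set Q | f Q != 0]); split.
- by have [] := regular_inv oV f_reg.
- by have VP : V P by []; split=> //=; rewrite fE.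
- by move=> Q [VQ /=]; rewrite fE // => Qjl; split; [case: VQ | exists j, l].
Qed.

End FermatCoordinates.

(** * Irreducibility of the Fermat quartic in characteristic 3 *)

Section PolynomialFacts.
Variable k : closedFieldType.

Lemma poly_neq0_point (p : {poly k}) : p != 0 -> exists t, p.[t] != 0.
Proof.
(* A polynomial vanishing everywhere is constant, since 1 + p has no root. *)
move=> p0; apply/not_existsP => pt0.
have {}pt0 t : p.[t] = 0.
  by have [//|pt] := eqVneq p.[t] 0; case: (pt0 t).
have [/size_poly1P[c c0 pE]|/closed_rootP[x]] := boolP (size (1 + p) == 1%N);
  last by rewrite rootE hornerD hornerC pt0 addr0 oner_eq0.
have e : p = (c - 1)%:P by rewrite polyCB -pE addrC addKr.
by move: p0; rewrite e polyC_eq0 -(hornerC (c - 1) 0) -e pt0 eqxx.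
Qed.

(** Evaluating a polynomial at a point with coordinates in S, followed by a
    specialization S -> k, is evaluating it at the specialized point. *)
Lemma rmorph_mmap n (S : comNzRingType) (f : {rmorphism k -> S})
    (phi : {rmorphism S -> k}) (h : 'I_n -> S) (p : {mpoly k[n]}) :
  (forall c, phi (f c) = c) -> phi (mmap f h p) = p.@[fun j => phi (h j)].
Proof.
move=> phif; rewrite mevalE [mmap _ _ _]/mmap rmorph_sum; apply: eq_bigr => m _.
rewrite rmorphM phif /mmap1 rmorph_prod; congr (_ * _).
by apply: eq_bigr => j _; rewrite rmorphXn.
Qed.

End PolynomialFacts.

(** The vector of homogeneous coordinates (w, x, y, z). *)
Definition row4 (R : nzRingType) (w x y z : R) : 'rV[R]_4 :=
  \row_(j < 4) [:: w; x; y; z]`_j.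

Lemma row4_eta (R : nzRingType) (u : 'rV[R]_4) : exists w x y z,
  u = row4 w x y z.
Proof.
exists (u 0 (inord 0)), (u 0 (inord 1)), (u 0 (inord 2)), (u 0 (inord 3)).
apply/rowP => j; rewrite mxE -[LHS]/(u 0 j) -[j in LHS]inord_val.
by case: j => [[|[|[|[|]]]] //].
Qed.

Lemma sum_row4 (R : nzRingType) (w x y z : R) :
  \sum_(j < 4) row4 w x y z 0 j ^+ 4 = w ^+ 4 + x ^+ 4 + y ^+ 4 + z ^+ 4.
Proof. by rewrite !big_ord_recl big_ord0 !mxE /= addr0 !addrA. Qed.

(** A parametrization of X by the plane, purely inseparable onto its image.
    With x = p + q, y = eps (p - q), w = r + s, z = eps (r - s) and
    eps ^+ 4 = -1, the equation of X becomes
    p ^+ 3 * q + p * q ^+ 3 + r ^+ 3 * s + r * s ^+ 3 = 0. *)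
Section Parametrization.
Variables (R : nzRingType) (eps al c : R).
Let q := c ^+ 9 - c.
Let s := al ^+ 3 + al.
Let p := q * al + c * s.
Let r := - (c ^+ 3 * q).

Definition param_w := r + s.
Definition param_x := p + q.
Definition param_y := eps * (p - q).
Definition param_z := eps * (r - s).

End Parametrization.

Definition param (R : nzRingType) (eps al c : R) : 'rV[R]_4 :=
  row4 (param_w al c) (param_x al c) (param_y eps al c) (param_z eps al c).

Section RangeOfParametrization.
Variables (k : closedFieldType) (char3 : 3%N \in [pchar k]).
Variables (i : k) (sqr_i : i ^+ 2 = -1).

Let eps : k := 1 + i.

Lemma expr3D (a b : k) : (a + b) ^+ 3 = a ^+ 3 + b ^+ 3.
Proof.
have -> : (a + b) ^+ 3 = a ^+ 3 + b ^+ 3 + 3%:R * (a ^+ 2 * b + a * b ^+ 2).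
  by ring.
by rewrite three_eq0 // mul0r addr0.
Qed.

Lemma expr9D (a b : k) : (a + b) ^+ 9 = a ^+ 9 + b ^+ 9.
Proof. by rewrite !(exprM _ 3 3) !expr3D. Qed.

Lemma expr3N (a : k) : (- a) ^+ 3 = - a ^+ 3.
Proof. by ring. Qed.

Lemma eps4 : eps ^+ 4 = -1.
Proof.
have -> : eps ^+ 4 = -1 + 3%:R * (-1) + (i ^+ 2 + 1) * (i ^+ 2 + 4%:R * i + 5%:R).
  by rewrite /eps; ring.
by rewrite sqr_i addNr mul0r three_eq0 // mul0r !addr0.
Qed.

Lemma eps_neq0 : eps != 0.
Proof.
by apply/eqP => e0; move/eqP: eps4; rewrite e0 expr0n eq_sym oppr_eq0 oner_eq0.
Qed.

Lemma fermat_pqrs (p q r s : k) :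
  (r + s) ^+ 4 + (p + q) ^+ 4 + (eps * (p - q)) ^+ 4 + (eps * (r - s)) ^+ 4
  = - (p ^+ 3 * q + p * q ^+ 3 + r ^+ 3 * s + r * s ^+ 3).
Proof.
rewrite !exprMn eps4.
transitivity (- (p ^+ 3 * q + p * q ^+ 3 + r ^+ 3 * s + r * s ^+ 3)
  + 3%:R * (3%:R * (p ^+ 3 * q + p * q ^+ 3 + r ^+ 3 * s + r * s ^+ 3))).
  by ring.
by rewrite three_eq0 // mul0r addr0.
Qed.

Lemma param_on_fermat (al c : k) : \sum_(j < 4) param eps al c 0 j ^+ 4 = 0.
Proof.
rewrite sum_row4 fermat_pqrs; apply/eqP; rewrite oppr_eq0; apply/eqP.
rewrite [((c ^+ 9 - c) * al + _) ^+ 3]expr3D; by ring.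
Qed.

(** The open subset of X covered by the parametrization: p, q, r, s are
    recovered from w, x, y, z using 1/2 = -1. *)
Definition param_range (w x y z : k) : Prop :=
  let q := - (x - eps^-1 * y) in let r := - (w + eps^-1 * z) in
  q != 0 /\ r ^+ 9 != r * q ^+ 8.

Lemma param_surj (w x y z : k) :
  w ^+ 4 + x ^+ 4 + y ^+ 4 + z ^+ 4 = 0 -> param_range w x y z ->
  exists al c m, [/\ m != 0, c ^+ 9 - c != 0 &
    row4 w x y z = m *: param eps al c].
Proof.
pose q := - (x - eps^-1 * y); pose r := - (w + eps^-1 * z).
pose p := - (x + eps^-1 * y); pose s := - (w - eps^-1 * z).
move=> wxyzX [q0 rq].
rewrite -/q -/r in q0 rq.
have e0 := eps_neq0.
have two : 1 + 1 = -1 :> k by exact: addr_1_1.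
have half (a b : k) : - (a + b) + - (a - b) = a.
  by transitivity (- (1 + 1) * a); [ring | rewrite two opprK mul1r].
have halfB (a b : k) : - (a + b) - - (a - b) = b.
  by transitivity (- (1 + 1) * b); [ring | rewrite two opprK mul1r].
have xE : x = p + q by rewrite /p /q half.
have yE : y = eps * (p - q) by rewrite /p /q halfB mulVKf.
have wE : w = r + s by rewrite /r /s half.
have zE : z = eps * (r - s) by rewrite /r /s halfB mulVKf.
clearbody p q r s.
have pqrs : p ^+ 3 * q + p * q ^+ 3 + r ^+ 3 * s + r * s ^+ 3 = 0.
  by apply/eqP; rewrite -oppr_eq0 -fermat_pqrs -xE -yE -wE -zE wxyzX.
(* Normalized by q = 1, the parameters are the cube root c of - r and
   al = p - c * s. *)
have [c cE] : exists c, c ^+ 3 = - (r / q).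
  have /closed_rootP[c] : size ('X^3 - (- (r / q))%:P : {poly k}) != 1%N.
    by rewrite size_XnsubC.
  by rewrite rootE !hornerE subr_eq0 => /eqP; exists c.
have eq0 : c ^+ 9 - c != 0.
  suff : (c ^+ 9 - c) ^+ 3 != 0 by rewrite expf_eq0.
  have -> : (c ^+ 9 - c) ^+ 3 = - ((r ^+ 9 - r * q ^+ 8) / q ^+ 9).
    rewrite expr3D expr3N -exprM (exprM _ 3 9) cE; by field.
  by rewrite oppr_eq0 mulf_neq0 ?invr_eq0 ?expf_neq0 // subr_eq0.
exists (p / q - c * (s / q)), c, (q / (c ^+ 9 - c)); split=> //.
  by rewrite mulf_neq0 ?invr_eq0.
set al := p / q - _; set e := c ^+ 9 - c in eq0 *.
have rE : r = - (c ^+ 3 * q) by rewrite cE mulNr opprK divfK.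
have sE : al ^+ 3 + al = e * (s / q).
  rewrite /al expr3D expr3N exprMn.
  have pE : (p / q) ^+ 3 + p / q = c ^+ 9 * (s / q) + c ^+ 3 * (s / q) ^+ 3.
    apply: (mulIf (expf_neq0 4 q0)); apply/eqP; rewrite -subr_eq0; apply/eqP.
    transitivity (p ^+ 3 * q + p * q ^+ 3 + r ^+ 3 * s + r * s ^+ 3) => //.
    by rewrite rE; field.
  transitivity ((p / q) ^+ 3 + p / q - c ^+ 3 * (s / q) ^+ 3 - c * (s / q)).
    by ring.
  by rewrite pE /e; ring.
rewrite /param /param_w /param_x /param_y /param_z -/e sE.
have [sE' pE'] : q / e * (e * (s / q)) = s /\
    q / e * (e * al + c * (e * (s / q))) = p.
  by rewrite /al; split; field; rewrite q0 eq0.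
have [qE' rE'] : q / e * e = q /\ q / e * - (c ^+ 3 * e) = r.
  by rewrite rE; split; field; rewrite eq0.
apply/rowP => j; rewrite !mxE.
case: j => [[|[|[|[|]]]] //=] _; rewrite ?[in LHS]wE ?[in LHS]xE ?[in LHS]yE ?[in LHS]zE.
- by rewrite -[X in X + _]rE' -[X in _ + X]sE' -mulrDr.
- by rewrite -[X in X + _]pE' -[X in _ + X]qE' -mulrDr.
- by rewrite -[X in _ * (X - _)]pE' -[X in _ * (_ - X)]qE' -mulrBr mulrCA.
- by rewrite -[X in _ * (X - _)]rE' -[X in _ * (_ - X)]sE' -mulrBr mulrCA.
Qed.

End RangeOfParametrization.

Section DensityOfRange.
Variables (k : closedFieldType) (char3 : 3%N \in [pchar k]).
Variables (i : k) (sqr_i : i ^+ 2 = -1).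
Local Notation eps := (1 + i).
Local Notation param_range := (param_range i).

(** With w ^+ 4 = - d, the second condition in param_range, where q is as there
    and zt = eps^-1 * z, follows from the nonvanishing of a polynomial in d, q, zt
    alone, because w ^+ 9 = d ^+ 2 * w makes it linear in w. *)
Lemma param_range_norm (w q zt d : k) : w ^+ 4 = - d ->
  d * (d ^+ 2 - q ^+ 8) ^+ 4 + zt ^+ 4 * (q ^+ 8 - zt ^+ 8) ^+ 4 != 0 ->
  (- (w + zt)) ^+ 9 != - (w + zt) * q ^+ 8.
Proof.
move=> wd; apply: contra => /eqP e.
have w8 : w ^+ 8 = d ^+ 2 by rewrite (exprM w 4 2) wd sqrrN.
have {}e : w * (d ^+ 2 - q ^+ 8) = zt * (q ^+ 8 - zt ^+ 8).
  have : (w + zt) ^+ 9 = (w + zt) * q ^+ 8.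
    by apply: oppr_inj; rewrite -[RHS]mulNr -e; ring.
  rewrite expr9D // (exprSr w) w8 => e'.
  apply/eqP; rewrite -subr_eq0; apply/eqP.
  transitivity (d ^+ 2 * w + zt ^+ 9 - (w + zt) * q ^+ 8); first by ring.
  by rewrite e' subrr.
by rewrite -exprMn -e exprMn wd mulNr subrr.
Qed.

Lemma fourth_roots_uniq (w : k) : w != 0 -> uniq [:: w; i * w; - w; - (i * w)].
Proof.
move=> w0; have two : 1 + 1 = -1 :> k by exact: addr_1_1.
have nn (a : k) : a != 0 -> a != - a.
  by move=> a0; rewrite -addr_eq0 -[a]mul1r -mulrDl two mulN1r oppr_eq0.
have n1 : 1 != -1 :> k by rewrite nn ?oner_neq0.
have i1 : i != 1.
  by apply: contraNneq n1 => e; rewrite -sqr_i e expr1n.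
have iN1 : i != -1.
  by apply: contraNneq n1 => e; rewrite -sqr_i e sqrrN expr1n.
have iw0 : i * w != 0.
  by rewrite mulf_neq0 //; apply: contraNneq n1 => e; move: sqr_i;
    rewrite e expr0n => /esym/eqP; rewrite oppr_eq0 oner_eq0.
have wi : w != i * w by rewrite -{1}[w]mul1r (inj_eq (mulIf w0)) eq_sym.
have wNi : w != - (i * w).
  by rewrite -{1}[w]mul1r -mulNr (inj_eq (mulIf w0)) eq_sym eqr_oppLR.
rewrite /= !inE !negb_or wi nn // wNi /= nn // !andbT /=.
by rewrite eq_sym eqr_oppLR wNi eqr_opp.
Qed.

(** Points in the range of the parametrization are dense in X. *)
Lemma param_range_dense (p : {mpoly k[4]}) (w x y z : k) :
  w ^+ 4 + x ^+ 4 + y ^+ 4 + z ^+ 4 = 0 ->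
  p.@[fun j => row4 w x y z 0 j] != 0 ->
  exists w' x' y' z', [/\ w' ^+ 4 + x' ^+ 4 + y' ^+ 4 + z' ^+ 4 = 0,
    param_range w' x' y' z' & p.@[fun j => row4 w' x' y' z' 0 j] != 0].
Proof.
move=> wX pw.
have e0 : eps != 0 by exact: eps_neq0.
have e4 : eps ^+ 4 = -1 by exact: eps4.
apply/not_existsP => none.
have {none} vanish w' x' y' z' : w' ^+ 4 + x' ^+ 4 + y' ^+ 4 + z' ^+ 4 = 0 ->
    param_range w' x' y' z' -> p.@[fun j => row4 w' x' y' z' 0 j] = 0.
  move=> h1 h2; apply/eqP; apply: contraT => h3.
  by case: (none w'); exists x', y', z'; split.
(* A point of the projected plane all of whose preimages are in the range. *)
have [p1 p1E] : exists a, a ^+ 3 + a = i.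
  have /closed_rootP[a] : size ('X^3 + ('X - i%:P) : {poly k}) != 1%N.
    by rewrite size_polyDl size_polyXn // size_XsubC.
  by rewrite rootE !hornerE ?addrA subr_eq0 => /eqP; exists a.
pose x1 := p1 + 1; pose y1 := eps * (p1 - 1).
have D1 : x1 ^+ 4 + y1 ^+ 4 = - i.
  have := fermat_pqrs char3 sqr_i p1 1 0 0.
  rewrite subr0 addr0 mulr0 !(expr0n, mul0r, mulr0, addr0, add0r) /=.
  by rewrite expr1n !mulr1 p1E.
(* The line joining it to the projection of the given point. *)
pose xt : {poly k} := x%:P + (x1 - x) *: 'X.
pose yt : {poly k} := y%:P + (y1 - y) *: 'X.
pose zt : {poly k} := z%:P - z *: 'X.
have xt0 : xt.[0] = x by rewrite /xt !hornerE ?(mulr0, addr0).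
have yt0 : yt.[0] = y by rewrite /yt !hornerE ?(mulr0, addr0).
have zt0 : zt.[0] = z by rewrite /zt !hornerE ?(mulr0, subr0, oppr0, addr0).
have xt1 : xt.[1] = x1.
  by rewrite /xt hornerD hornerC hornerZ hornerX mulr1 addrC subrK.
have yt1 : yt.[1] = y1.
  by rewrite /yt hornerD hornerC hornerZ hornerX mulr1 addrC subrK.
have zt1 : zt.[1] = 0.
  by rewrite /zt hornerD hornerN hornerC hornerZ hornerX mulr1 subrr.
clearbody xt yt zt.
pose dt := xt ^+ 4 + yt ^+ 4 + zt ^+ 4.
pose qt := - (xt - eps^-1 *: yt).
pose st := eps^-1 *: zt.
have dtE t : dt.[t] = xt.[t] ^+ 4 + yt.[t] ^+ 4 + zt.[t] ^+ 4.
  by rewrite /dt !hornerE.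
have qtE t : qt.[t] = - (xt.[t] - eps^-1 * yt.[t]) by rewrite /qt !hornerE.
have stE t : st.[t] = eps^-1 * zt.[t] by rewrite /st !hornerE.
clearbody dt qt st.
pose norm := dt * (dt ^+ 2 - qt ^+ 8) ^+ 4
  + st ^+ 4 * (qt ^+ 8 - st ^+ 8) ^+ 4.
have normE t : norm.[t] = dt.[t] * (dt.[t] ^+ 2 - qt.[t] ^+ 8) ^+ 4
    + st.[t] ^+ 4 * (qt.[t] ^+ 8 - st.[t] ^+ 8) ^+ 4.
  by rewrite /norm !hornerE.
clearbody norm.
pose bad := qt * (dt * norm).
have two : 1 + 1 = -1 :> k by exact: addr_1_1.
have bad1 : bad.[1] != 0.
  have dt1 : dt.[1] = - i by rewrite dtE xt1 yt1 zt1 D1 expr0n addr0.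
  have qt1 : qt.[1] = 1.
    rewrite qtE xt1 yt1 /y1 mulKf // /x1.
    transitivity (- (1 + 1) : k); first by ring.
    by rewrite two opprK.
  rewrite /bad !hornerM normE dt1 qt1 stE zt1 mulr0 expr0n /= mul0r addr0.
  rewrite sqrrN sqr_i expr1n mul1r -opprD two opprK expr1n mulr1.
  by rewrite mulrNN -expr2 sqr_i oppr_eq0 oner_neq0.
pose F : {poly {poly k}} :=
  mmap (polyC \o polyC) (fun j => [:: 'X; xt%:P; yt%:P; zt%:P]`_j) p.
have FE t u : F.[u%:P].[t] =
    p.@[fun j => row4 u xt.[t] yt.[t] zt.[t] 0 j].
  have := @rmorph_mmap k 4 _ (polyC \o polyC)
    (horner_eval t \o horner_eval u%:P) (fun j => [:: 'X; xt%:P; yt%:P; zt%:P]`_j)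
    p.
  rewrite /= /horner_eval => -> => [|c]; last by rewrite !hornerC.
  apply: meval_eq => j; rewrite mxE.
  by case: j => [[|[|[|[|]]]] //=] _; rewrite ?hornerX ?hornerC.
pose d : {poly {poly k}} := 'X^4 - (- dt)%:P.
have d_monic : d \is monic by rewrite monicXnsubC.
have FqR := Pdiv.RingMonic.rdivp_eq d_monic F.
set Q := Pdiv.Ring.rdivp F d in FqR; set r := Pdiv.Ring.rmodp F d in FqR.
have szr : (size r <= 4)%N.
  by rewrite -ltnS -(size_XnsubC (- dt) (n := 4)) // Pdiv.Ring.ltn_rmodpN0 ?monic_neq0.
have dE t u : d.[u%:P].[t] = u ^+ 4 + dt.[t] by rewrite /d !hornerE opprK.
(* The remainder, of degree at most 3 in w, has four roots over almost every point
   of the line. *)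
have r0 : r = 0.
  apply/polyP => j; rewrite coef0; apply/eqP/negPn/negP => rj.
  have [|t] := poly_neq0_point (p := r`_j * bad).
    rewrite mulf_neq0 //; apply: contraNneq bad1 => ->.
    by rewrite horner0.
  rewrite hornerM mulf_eq0 negb_or => /andP[rjt].
  rewrite /bad !hornerM !mulf_eq0 !negb_or normE => /and3P[qt0 dt0 norm0].
  pose rt := map_poly (horner_eval t) r.
  have rtj : rt`_j != 0 by rewrite coef_map_id0 ?/horner_eval ?horner0.
  have rt0 : rt != 0 by apply: contraNneq rtj => ->; rewrite coef0.
  have [u0 u0E] : exists u, u ^+ 4 = - dt.[t].
    have /closed_rootP[a] : size ('X^4 - (- dt.[t])%:P : {poly k}) != 1%N.
      by rewrite size_XnsubC.
    by rewrite rootE !hornerE subr_eq0 => /eqP; exists a.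
  have roots u : u ^+ 4 = - dt.[t] -> root rt u.
    move=> u4; rewrite rootE.
    have -> : rt.[u] = r.[u%:P].[t].
      by rewrite -[RHS](horner_map (horner_eval t)) /= /horner_eval hornerC.
    have <- : F.[u%:P].[t] = r.[u%:P].[t].
      by rewrite FqR hornerD hornerM hornerD hornerM dE u4 addNr mulr0 add0r.
    rewrite FE vanish //; first by rewrite u4 dtE; ring.
    rewrite /param_range -qtE -stE; split=> //.
    exact: param_range_norm u4 norm0.
  have u00 : u0 != 0.
    by apply: contraNneq dt0 => e; rewrite -oppr_eq0 -u0E e expr0n.
  have i4 : i ^+ 4 = 1 by rewrite (exprM i 2 2) sqr_i sqrrN expr1n.
  have all_roots : all (root rt) [:: u0; i * u0; - u0; - (i * u0)].
    have neg4 (a : k) : (- a) ^+ 4 = a ^+ 4 by ring.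
    have iu4 : (i * u0) ^+ 4 = - dt.[t] by rewrite exprMn i4 mul1r.
    apply/and5P; split=> //; apply: roots => //; rewrite neg4 //.
  have := max_poly_roots rt0 all_roots (fourth_roots_uniq u00).
  by rewrite ltnNge (leq_trans (size_poly _ _) szr).
move/eqP: pw; apply.
transitivity (F.[w%:P].[0]); first by rewrite FE xt0 yt0 zt0.
rewrite FqR r0 addr0 hornerM hornerM dE dtE xt0 yt0 zt0.
by rewrite !addrA wX mulr0.
Qed.

End DensityOfRange.

Section OpenSetsMeet.
Variables (k : closedFieldType) (char3 : 3%N \in [pchar k]).
Variables (i : k) (sqr_i : i ^+ 2 = -1).
Local Notation eps := (1 + i).
Local Notation X := (fermat_quartic k).

Lemma form_nonzero_on_param d (p : {mpoly k[4]}) (u : 'rV[k]_4) :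
  p \is d.-homog -> \sum_(j < 4) u 0 j ^+ 4 = 0 -> p.@[fun j => u 0 j] != 0 ->
  exists al c, c ^+ 9 - c != 0 /\ p.@[fun j => param eps al c 0 j] != 0.
Proof.
move=> hp; have [w [x [y [z ->]]]] := row4_eta u.
rewrite sum_row4 => uX pu.
have [w' [x' [y' [z' [vX vr pv]]]]] := param_range_dense char3 sqr_i uX pu.
have [al [c [m [m0 c0 e]]]] := param_surj char3 sqr_i vX vr.
exists al, c; split=> //; move: pv.
by rewrite e (meval_homog_scale _ _ hp) mulf_eq0 negb_or => /andP[].
Qed.

(** Two forms that do not vanish identically on X have a common point of
    nonvanishing: both are nonzero on the image of a line of the parameter
    plane. *)
Lemma forms_nonzero_together d1 d2 (p1 p2 : {mpoly k[4]}) (u1 u2 : 'rV[k]_4) :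
  p1 \is d1.-homog -> \sum_(j < 4) u1 0 j ^+ 4 = 0 ->
  p1.@[fun j => u1 0 j] != 0 ->
  p2 \is d2.-homog -> \sum_(j < 4) u2 0 j ^+ 4 = 0 ->
  p2.@[fun j => u2 0 j] != 0 ->
  exists u : 'rV[k]_4, [/\ u != 0, \sum_(j < 4) u 0 j ^+ 4 = 0,
    p1.@[fun j => u 0 j] != 0 & p2.@[fun j => u 0 j] != 0].
Proof.
move=> h1 u1X pu1 h2 u2X pu2.
have [a1 [c1 [c10 pc1]]] := form_nonzero_on_param h1 u1X pu1.
have [a2 [c2 [c20 pc2]]] := form_nonzero_on_param h2 u2X pu2.
pose line (b1 b2 : k) : {poly k} := b1%:P + (b2 - b1) *: 'X.
have line0 b1 b2 : (line b1 b2).[0] = b1.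
  by rewrite hornerD hornerC hornerZ hornerX mulr0 addr0.
have line1 b1 b2 : (line b1 b2).[1] = b2.
  by rewrite hornerD hornerC hornerZ hornerX mulr1 addrC subrK.
clearbody line; pose al := line a1 a2; pose c := line c1 c2.
have [al0 al1] : al.[0] = a1 /\ al.[1] = a2 by rewrite line0 line1.
have [ct0 ct1] : c.[0] = c1 /\ c.[1] = c2 by rewrite line0 line1.
clearbody al c.
pose curve (p : {mpoly k[4]}) : {poly k} :=
  mmap polyC (fun j => param eps%:P al c 0 j) p.
have curveE p t : (curve p).[t] = p.@[fun j => param eps al.[t] c.[t] 0 j].
  have := @rmorph_mmap k 4 _ polyC (horner_eval t)
    (fun j => param eps%:P al c 0 j) p.
  rewrite /= /horner_eval => -> => [|b]; last by rewrite hornerC.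
  apply: meval_eq => j; rewrite !mxE.
  rewrite /param_w /param_x /param_y /param_z.
  by case: j => [[|[|[|[|]]]] //=] _; rewrite !hornerE.
have [|t] := poly_neq0_point (p := curve p1 * curve p2 * (c ^+ 9 - c)).
  rewrite !mulf_neq0 //.
  - by apply: contraNneq pc1 => e; rewrite -al0 -ct0 -curveE e horner0.
  - by apply: contraNneq pc2 => e; rewrite -al1 -ct1 -curveE e horner0.
  - by apply: contraNneq c10 => e; rewrite -ct0 -horner_exp -hornerN -hornerD e horner0.
rewrite !hornerM !mulf_eq0 !negb_or => /andP[/andP[p1t p2t]].
rewrite hornerD hornerN horner_exp => ct.
exists (param eps al.[t] c.[t]); split.
- (* If param vanishes, so does its coordinate q = c ^+ 9 - c. *)
  apply: contraNneq ct => /rowP e.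
  have := e (inord 1); have := e (inord 2).
  rewrite !mxE !inordK //= /param_x /param_y => /eqP.
  rewrite mulf_eq0 (negPf (eps_neq0 char3 sqr_i)) /= subr_eq0 => /eqP ->.
  rewrite -[X in X + X = _ -> _]mul1r -mulrDl addr_1_1 // mulN1r => /eqP.
  by rewrite oppr_eq0.
- exact: param_on_fermat.
- by rewrite -curveE.
- by rewrite -curveE.
Qed.

(** X is irreducible. *)
Lemma fermat_open_meet (U V : set X) P Q :
  open U -> open V -> U P -> V Q -> exists S, U S /\ V S.
Proof.
move=> [A oA AU] [B oB BV]; rewrite -AU -BV => AP BQ.
have [d1 [p1 [h1 p1P p1A]]] := oA _ AP.
have [d2 [p2 [h2 p2Q p2B]]] := oB _ BQ.
have PX := fermat_line_eq (val_pcoord (fermat_incl P)).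
have QX := fermat_line_eq (val_pcoord (fermat_incl Q)).
have [u [u0 uX pu1 pu2]] := forms_nonzero_together h1 PX p1P h2 QX p2Q.
have [S Su] := fermat_point u0 uX.
exists S; split; [apply: p1A | apply: p2B].
- by rewrite (peval_neq0 h1 Su).
- by rewrite (peval_neq0 h2 Su).
Qed.

End OpenSetsMeet.

(** * The involution *)

(** The product of the quantities that line_quadric_points requires to be nonzero,
    for the points (w, x, y, 1) and H. *)
Definition fibre_generic (R : nzRingType) (i w x y : R) : R :=
  let a := F10 i w x y in let b := F11 i w x y in let c := F12 i w x y in
  let h0 := H10 i w x y in let h1 := H11 i w x y in
  let h2 := H12 i w x y in let h3 := H13 i w x y in
  planes_minor i a b c * (y * h3 - 1 * h2) *
    polar i a b c w x y 1 h0 h1 h2 h3.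

Local Ltac find_expr i w x y :=
  rewrite /fibre_generic; expand; lazymatch goal with |- eval _ _ _ _ ?e = ?t =>
    let r := reify i w x y t in unify e r end; reflexivity.

Definition fibre_generic_reified :
  {e | forall (R : nzRingType) (i w x y : R),
    eval i w x y e = fibre_generic i w x y}.
Proof. by eexists => R i w x y; find_expr i w x y. Defined.

Lemma H1_expr (j : 'I_4) : exists e, forall (k : fieldType) (i w x y : k),
  eval i w x y e = H1 i w x y 0 j.
Proof.
case: j => [[|[|[|[|]]]] //=] hj; eexists => R i w x y; rewrite mxE /=;
  find_expr i w x y.
Qed.

(** The value of an expression at an F_9-rational point. *)
Fixpoint f9eval (w x y : f9) (e : expr) : f9 :=
  match e with
  | EOne => (T1, T0) | EI => (T0, T1) | EW => w | EX => x | EY => y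
  | EAdd a b => f9add (f9eval w x y a) (f9eval w x y b)
  | EOpp a => f9opp (f9eval w x y a)
  | EMul a b => f9mul (f9eval w x y a) (f9eval w x y b)
  | EExp a n => iter n (f9mul (f9eval w x y a)) (T1, T0)
  end.

Section Involution.
Variables (k : closedFieldType) (char3 : 3%N \in [pchar k]).
Variables (i : k) (sqr_i : i ^+ 2 = -1).
Local Notation X := (fermat_quartic k).
Implicit Types P Q : X.

Lemma f9evalE w x y e :
  f9val i (f9eval w x y e) = eval i (f9val i w) (f9val i x) (f9val i y) e.
Proof.
elim: e => //= [||a IHa b IHb|a IHa|a IHa b IHb|a IHa n].
- exact: f9val1.
- by rewrite /f9val /= add0r mul1r.
- by rewrite (f9valD char3) IHa IHb.
- by rewrite f9valN IHa.
- by rewrite (f9valM char3 sqr_i) IHa IHb.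
- elim: n => [|n IHn]; first exact: f9val1.
  by rewrite iterS (f9valM char3 sqr_i) IHn IHa exprS.
Qed.

(** The point (0, 0, -(1 + i)) of X satisfies the genericity condition. *)
Lemma fibre_generic_point : exists w x y : k,
  w ^+ 4 + x ^+ 4 + y ^+ 4 + 1 = 0 /\ fibre_generic i w x y != 0.
Proof.
pose w := f9val i (T0, T0); pose y := f9val i (T2, T2).
exists w, w, y; split.
  have -> : w ^+ 4 + w ^+ 4 + y ^+ 4 + 1 = eval i w w y (EAdd (EAdd (EAdd
    (EExp EW 4) (EExp EX 4)) (EExp EY 4)) EOne) by [].
  by rewrite -f9evalE; exact: f9val0.
rewrite -(svalP fibre_generic_reified) -f9evalE.
apply: (f9val_neq0 char3 sqr_i).
by vm_compute.
Qed.

(** The affine coordinates of a point with z nonzero. *)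
Definition wcoord P : k := affine_coord (inord 3) (inord 0) P.
Definition xcoord P : k := affine_coord (inord 3) (inord 1) P.
Definition ycoord P : k := affine_coord (inord 3) (inord 2) P.

Lemma row4_neq0 (w x y : k) : row4 w x y 1 != 0.
Proof.
apply/eqP => /rowP/(_ (inord 3))/eqP.
by rewrite !mxE inordK //= oner_eq0.
Qed.

Lemma chart_line P : chart (inord 3) P ->
  val (fermat_incl P) = <[row4 (wcoord P) (xcoord P) (ycoord P) 1]>%VS.
Proof.
move=> P3; rewrite val_pcoord -[pcoord _]/(fermat_coord P).
rewrite -[in RHS](vline_scale _ P3); congr <[_]>%VS.
apply/rowP => j; rewrite mxE [row4 _ _ _ _ _ _]mxE -[j in LHS]inord_val.
by case: j => [[|[|[|[|]]]] //= _]; rewrite ?mulr1 // mulrC divfK.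
Qed.

Lemma line_chart P w x y : val (fermat_incl P) = <[row4 w x y 1]>%VS ->
  [/\ chart (inord 3) P, wcoord P = w, xcoord P = x & ycoord P = y].
Proof.
move=> /pcoord_line[s s0 e].
rewrite /chart /= /wcoord /xcoord /ycoord /affine_coord /fermat_coord e !mxE !inordK //=.
have sK a : s * a / s = a by rewrite mulrC mulKf.
by rewrite mulr1 !sK.
Qed.

Lemma chart_equation P : chart (inord 3) P ->
  wcoord P ^+ 4 + xcoord P ^+ 4 + ycoord P ^+ 4 + 1 = 0.
Proof. by move=> /chart_line/fermat_line_eq; rewrite sum_row4 expr1n. Qed.

Lemma regular_coord_eval e :
  regular (chart (inord 3)) (fun P => eval i (wcoord P) (xcoord P) (ycoord P) e).
Proof. by apply: regular_eval; [exact: chart_open|..]; exact: affine_coord_regular. Qed.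

(** The open set of points whose fibre is controlled by line_quadric_points. *)
Definition generic_locus : set X := chart (inord 3) `&`
  [set P | fibre_generic i (wcoord P) (xcoord P) (ycoord P) != 0].

Lemma generic_locus_open : open generic_locus.
Proof.
by have [] := regular_inv (@chart_open k (inord 3))
  (regular_coord_eval (sval fibre_generic_reified)).
Qed.

Lemma generic_locus_neq0 : exists P, generic_locus P.
Proof.
have [w [x [y [wX wG]]]] := fibre_generic_point.
have [|P Pw] := fermat_point (row4_neq0 w x y).
  by rewrite sum_row4 expr1n.
by exists P; have [P3 ew ex ey] := line_chart Pw; split=> //=; rewrite ew ex ey.
Qed.

Lemma generic_F1_neq0 w x y : fibre_generic i w x y != 0 -> F1 i w x y != 0.
Proof.
apply: contraNneq => /rowP F0.
have := F0 (inord 0); have := F0 (inord 1); have := F0 (inord 2).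
rewrite !mxE !inordK //= => e2 e1 e0.
by rewrite /fibre_generic e0 e1 e2 /planes_minor /plane1w /plane1x !(mulr0, mul0r, addr0, subr0, oppr0).
Qed.

Lemma generic_H1_neq0 w x y : fibre_generic i w x y != 0 -> H1 i w x y != 0.
Proof.
apply: contraNneq => /rowP H0; have := H0 (inord 2); have := H0 (inord 3).
rewrite !mxE !inordK //= => e3 e2.
by rewrite /fibre_generic e3 e2 !(mulr0, mul0r, subr0).
Qed.

Lemma H1_regular j : regular (chart (inord 3))
  (fun P => H1 i (wcoord P) (xcoord P) (ycoord P) 0 j).
Proof.
have [e evalE] := H1_expr j.
apply: (regular_eq (@chart_open k (inord 3)) _ (regular_coord_eval e)).
by move=> P _; rewrite evalE.
Qed.

(** If P and Q are generic points of X with the same image under [F10 : F11 : F12],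
    then Q is P or the point [H10 : H11 : H12 : H13] at P. *)
Lemma fibre_points P Q : generic_locus P -> generic_locus Q ->
  <[F1 i (wcoord P) (xcoord P) (ycoord P)]>%VS =
  <[F1 i (wcoord Q) (xcoord Q) (ycoord Q)]>%VS ->
  Q = P \/
  val (fermat_incl Q) = <[H1 i (wcoord P) (xcoord P) (ycoord P)]>%VS.
Proof.
move=> [P3 /= PG] [Q3 /= QG] PQ.
have PX := chart_equation P3; have QX := chart_equation Q3.
have Pline := chart_line P3; have Qline := chart_line Q3.
move: (wcoord P) (xcoord P) (ycoord P) (wcoord Q) (xcoord Q) (ycoord Q)
  PX QX PG QG PQ Pline Qline => w x y w' x' y' PX QX PG QG PQ Pline Qline.
have [s sF] : exists s, F1 i w x y = s *: F1 i w' x' y'.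
  have : F1 i w x y \in <[F1 i w' x' y']>%VS by rewrite -PQ memv_line.
  by move/vlineP => [s ->]; exists s.
have [F0 F1' F2] : [/\ F10 i w x y = s * F10 i w' x' y',
    F11 i w x y = s * F11 i w' x' y' & F12 i w x y = s * F12 i w' x' y'].
  by split; have /rowP := sF; [move=> /(_ (inord 0)) | move=> /(_ (inord 1)) |
    move=> /(_ (inord 2))]; rewrite !mxE inordK.
(* The fibre equations are homogeneous in the coordinates of the image. *)
have Q1 : plane1 i (F10 i w x y) (F11 i w x y) (F12 i w x y) w' x' y' 1 = 0.
  transitivity (s * plane1 i (F10 i w' x' y') (F11 i w' x' y') (F12 i w' x' y')
    w' x' y' 1); last by rewrite plane1_fibre // mulr0.
  by rewrite F0 F1' F2 /plane1 /plane1w /plane1x /plane1y /plane1z; ring.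
have Q2 : plane2 i (F10 i w x y) (F11 i w x y) (F12 i w x y) w' x' y' 1 = 0.
  transitivity (s ^+ 2 * plane2 i (F10 i w' x' y') (F11 i w' x' y')
    (F12 i w' x' y') w' x' y' 1); last by rewrite plane2_fibre // mulr0.
  by rewrite F0 F1' F2 /plane2 /plane2w /plane2x /plane2y /plane2z; ring.
have Qq : quadric i (F10 i w x y) (F11 i w x y) (F12 i w x y) w' x' y' 1 = 0.
  transitivity (s * quadric i (F10 i w' x' y') (F11 i w' x' y') (F12 i w' x' y')
    w' x' y' 1); last by rewrite quadric_fibre // mulr0.
  by rewrite F0 F1' F2 /quadric; ring.
have H0 := generic_H1_neq0 PG.
move: PG; rewrite /fibre_generic !mulf_eq0 !negb_or => /andP[/andP[m0 d0] p0].
have [t [[ew ex ey ez]|[ew ex ey ez]]] := line_quadric_points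
  (plane1_fibre char3 sqr_i PX) (plane2_fibre char3 sqr_i PX)
  (quadric_fibre char3 sqr_i PX) (plane1_conjugate char3 sqr_i PX)
  (plane2_conjugate char3 sqr_i PX) (quadric_conjugate char3 sqr_i PX)
  Q1 Q2 Qq m0 d0 p0.
- left; apply: val_inj; apply: val_inj.
  rewrite -[LHS]/(val (fermat_incl Q)) -[RHS]/(val (fermat_incl P)).
  by rewrite Pline Qline ew ex ey -[t]mulr1 -ez !mul1r.
- right; rewrite Qline.
  have -> : row4 w' x' y' 1 = t *: H1 i w x y.
    by apply/rowP => j; rewrite !mxE; case: j => [[|[|[|[|]]]] //=].
  rewrite vline_scale //; apply: contraTneq (oner_neq0 k) => t0.
  by rewrite ez t0 mul0r eqxx.
Qed.

End Involution.

Theorem theorem7p1 (k : closedFieldType) (char3 : 3%N \in [pchar k])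
    (i : k) (sqr_i : i ^+ 2 = -1)
    (g : fermat_quartic k -> fermat_quartic k) (g1P : is_g1 i g) :
  induced_by (H1 i) (fun P => fermat_incl (g P)).
Proof.
have meet := fermat_open_meet char3 sqr_i.
have [G0 G0G] := generic_locus_neq0 char3 sqr_i.
have oG := generic_locus_open i.
split.
  move=> O [P OP] oO; have [S [SO [S3 SG]]] := meet _ _ _ _ oO oG OP G0G.
  exists S; split=> //; exists (wcoord S), (xcoord S), (ycoord S).
  by split; [exact: chart_line | exact: generic_H1_neq0].
have [phi [Y [rho [pi [tau [[_ [_ phiF] _] stein [deck [y0 tauy]]
  [g_iso _ g_tau]]]]]]] := g1P.
have [g' [g_mor _ gK g'K]] := g_iso.
have phig P : phi (g P) = phi P.
  have [_ _ _ rhoE] := stein; have [_ pi_tau] := deck.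
  by rewrite -!rhoE g_tau pi_tau.
(* g is not the identity. *)
have [P1 gP1] : exists P, g P <> P.
  have [x tx] := deck_transformation_moves stein deck tauy.
  by exists x => gx; apply: tx; rewrite -g_tau gx.
move=> P w x y Pline HP; apply: contrapT => gP.
have [P3 ew ex ey] := line_chart Pline.
(* U2: the points Q of the chart where g Q is not the point H1 at Q. *)
pose U2 := chart (k := k) (inord 3) `&` [set Q | exists j l,
  fermat_coord (g Q) 0 j * H1 i (wcoord Q) (xcoord Q) (ycoord Q) 0 l !=
  fermat_coord (g Q) 0 l * H1 i (wcoord Q) (xcoord Q) (ycoord Q) 0 j].
have oU2 : open U2.
  by apply: not_on_line_open => //; [exact: chart_open | exact: H1_regular].
have U2P : U2 P.
  split=> //=; rewrite ew ex ey; apply: contrapT => no.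
  apply: gP; apply/(pcoord_collinear _ HP) => j l; apply/eqP.
  by apply: contrapT => /negP ne; apply: no; exists j, l.
(* U1: the points Q, in a chart around P1, where g Q is not Q. *)
have /rV0Pn[m P1m] : fermat_coord P1 != 0 by exact: pcoord_neq0.
pose U1 := chart m `&` [set Q | exists j l,
  fermat_coord (g Q) 0 j * affine_coord m l Q !=
  fermat_coord (g Q) 0 l * affine_coord m j Q].
have oU1 : open U1.
  by apply: not_on_line_open => //; [exact: chart_open |];
    exact: affine_coord_regular.
have U1P : U1 P1.
  split=> //=; apply: contrapT => no; apply: gP1.
  apply: val_inj; apply: val_inj.
  rewrite -[LHS]/(val (fermat_incl (g P1))) -[RHS]/(val (fermat_incl P1)).
  rewrite [RHS]val_pcoord; apply/(pcoord_collinear _ (pcoord_neq0 _)) => j l.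
  apply/eqP; apply: contrapT => /negP ne; apply: no; exists j, l.
  apply: contra ne; rewrite /affine_coord !mulrA => /eqP e.
  by apply/eqP/(mulIf (invr_neq0 P1m)).
have oG' : open (g @^-1` generic_locus i).
  by have [g_cont _] := g_mor; move/continuousP: g_cont; apply.
(* All the open sets considered meet. *)
have [S1 S1U] := meet _ _ _ _ oU1 oU2 U1P U2P.
have [S2 [S2G S2G']] := meet _ _ _ (g' G0) oG oG' G0G
  (eq_ind_r (generic_locus i) G0G (g'K G0)).
have oU := openI oU1 oU2; have oGG := openI oG oG'.
have [Q [[[Qm gQ] [Q3 /= HQ]] [QG QG']]] :=
  meet _ _ _ _ oU oGG S1U (conj S2G S2G').
have phi_line R : generic_locus i R ->
    val (phi R) = <[F1 i (wcoord R) (xcoord R) (ycoord R)]>%VS.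
  move=> [R3 RG]; apply: phiF; first exact: chart_line.
  exact: generic_F1_neq0.
have [gQQ|gQH] := fibre_points char3 sqr_i QG QG' (etrans (esym (phi_line _ QG))
  (etrans (congr1 val (esym (phig Q))) (phi_line _ QG'))).
- case: gQ => j [l /eqP]; apply.
  by rewrite gQQ /affine_coord mulrCA.
- case: HQ => j [l /eqP]; apply; case: QG => _ QG.
  exact: (pcoord_collinear _ (generic_H1_neq0 QG)).1 gQH j l.
Qed.
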